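(* Let $G=(V,E)$ be any graph with $n=|V|$ vertices and bounded degrees, with maximum degree $\Delta\ge1$. For any $\gamma\in(0,1/2]$ and $\alpha\ge 1$ there exists $C=C(\alpha,\Delta)$ so that the cover time $T_{\mathrm{cov}}$ of the local search allocation on $G$ satisfies $$\mathbf{Pr}\left[\,T_{\mathrm{cov}}<\frac{\gamma R_2^{(\gamma)}(G)\,n}{8\Delta}\,\right]\le n^{-\omega(1)}\qquad\text{and}\qquad \mathbf{Pr}\left[\,T_{\mathrm{cov}}\ge C\,R_2(G)\,n\,\right]\le n^{-\alpha}.$$ Explicitly: for every $\Delta\ge1$ and all constants $\gamma\in(0,1/2]$, $\alpha\ge1$ there is $C=C(\alpha,\Delta)$ such that for every $A>0$ there is $n_0=n_0(\Delta,\gamma,\alpha,A)$ such that for every graph $G$ with $n\ge n_0$ vertices and maximum degree $\Delta$, the first probability is at most $n^{-A}$ and the second is at most $n^{-\alpha}$.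
   Context: Graphs are finite and undirected, not necessarily connected. $d_G(u,v)$ is the graph distance ($\infty$ if $u,v$ lie in different components) and $B_u^r=\{v\in V: d_G(u,v)\le r\}$. With $\mathbb{N}=\{1,2,\dots\}$ and $\log$ the natural logarithm, define $$R_2(G)=\min\{r\in\mathbb{N}: r\,|B_u^r|\ge \log n\ \text{for all } u\in V\},$$ and, for $\gamma\in(0,1/2]$, $$R_2^{(\gamma)}(G)=\max\{r\in\mathbb{N}:\ \text{there exists } S\subseteq V\text{ with }|S|\ge n^{\frac12+\gamma}\text{ such that } r\,|B_u^r|<\log n\text{ for all }u\in S\}.$$ Local search allocation on $G$: initially all vertices have load $0$. Balls $1,2,\dots$ arrive one at a time. Ball $i$ is born at a vertex $U_i$ (its birthplace) chosen independently and uniformly at random from $V$. Starting at its birthplace, in each step the ball moves to a neighbour of its current vertex having the smallest load among all neighbours, provided that this load is strictly smaller than the load of the current vertex; ties between smallest-load neighbours are broken independently and uniformly at random. The ball stops at the first vertex visited that has no neighbour of strictly smaller load, and it is allocated there, increasing that vertex's load by $1$. Then the next ball arrives. $X_v^{(m)}$ denotes the load of $v$ after $m$ balls have been allocated. The cover time is $T_{\mathrm{cov}}=\min\{m\ge 0: X_v^{(m)}\ge 1\text{ for all }v\in V\}$. *)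

(* Defs.v *)
From mathcomp Require Import all_boot all_order all_algebra.
From mathcomp Require Import all_classical all_reals all_analysis.

Set Implicit Arguments.
Unset Strict Implicit.
Unset Printing Implicit Defensive.

Import Order.TTheory GRing.Theory Num.Theory.

Local Open Scope classical_set_scope.
Local Open Scope ring_scope.

Record graph := Graph {
  vertex :> finType;
  adj : rel vertex;
  adj_sym : symmetric adj;
  adj_irrefl : irreflexive adj }.

Definition degree (G : graph) (u : G) : nat := #|[set v | adj u v]%SET|.

Definition max_degree (G : graph) : nat := \max_(u : G) degree u.

(* [ereal_inf] of the empty set is [+oo]; on a nonempty set of naturals the
   infimum is attained. *)
Definition min_or_infty (R : realType) (A : set nat) : \bar R :=
  ereal_inf [set m%:R%:E | m in A].

Definition gdist (R : realType) (G : graph) (u v : G) : \bar R :=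
  min_or_infty R
    [set k | exists p : seq G, [/\ path (@adj G) u p, last u p = v & size p = k]].

Definition gball (R : realType) (G : graph) (u : G) (r : nat) : {set G} :=
  [set v | (gdist R u v <= r%:R%:E)%E]%SET.

(* Junk value 0 when the minimum (maximum) does not exist. *)
Definition nat_min (A : set nat) : nat := xget 0%N (A `&` lbound A).
Definition nat_max (A : set nat) : nat := xget 0%N (A `&` ubound A).

Definition R2 (R : realType) (G : graph) : nat :=
  nat_min [set r | (0 < r)%N /\
    forall u : G, ln (#|G|%:R : R) <= r%:R * #|gball R u r|%:R].

(* For nonempty [G] the elements of the set are smaller than [ln #|G|]; for
   [gamma <= 1/2] the set contains [1] (take all of [G] for [S]) as soon as
   [1 + max_degree G < ln #|G|]. So with bounded degrees the junk value of
   [nat_max] only concerns small graphs. *)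
Definition R2gamma (R : realType) (gamma : R) (G : graph) : nat :=
  nat_max [set r | (0 < r)%N /\
    exists S : {set G}, #|G|%:R `^ (2^-1 + gamma) <= #|S|%:R /\
      forall u, u \in S -> r%:R * #|gball R u r|%:R < ln (#|G|%:R : R)].

(* The trajectory [(u, q)] of a ball: its birthplace [u], and the list [q] of
   the vertices it moves to, in order. *)
Definition trajectory (G : graph) : Type := (G * seq G)%type.

Definition endpoint (G : graph) (p : trajectory G) : G := last p.1 p.2.

Definition load (G : graph) (h : seq (trajectory G)) (v : G) : nat :=
  count (fun p => endpoint p == v) h.

Definition local_min (G : graph) (x : G -> nat) (u : G) : bool :=
  [forall v, adj u v ==> (x u <= x v)%N].

Definition next_vertices (G : graph) (x : G -> nat) (u : G) : {set G} :=
  [set v | [&& adj u v, (x v < x u)%N &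
               [forall w, adj u w ==> (x v <= x w)%N]]]%SET.

(* Probability that a ball sitting at [u], under the loads [x], performs
   exactly the moves [q] and then stops. *)
Fixpoint walk_prob (R : realType) (G : graph) (x : G -> nat) (u : G)
    (q : seq G) : R :=
  match q with
  | [::] => (local_min x u)%:R
  | v :: q' =>
      if v \in next_vertices x u then
        #|next_vertices x u|%:R^-1 * walk_prob R x v q'
      else 0
  end.

Definition trajectory_prob (R : realType) (G : graph) (x : G -> nat)
    (p : trajectory G) : R :=
  #|G|%:R^-1 * walk_prob R x p.1 p.2.

(* Probability that the balls following those of [past] have, one after the
   other, the trajectories listed in [h]. *)
Fixpoint history_prob (R : realType) (G : graph) (past h : seq (trajectory G))
    : R :=
  match h with
  | [::] => 1
  | p :: h' =>
      trajectory_prob R (load past) p * history_prob R (rcons past p) h'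
  end.

Definition history (G : graph) (T : Type) (W : nat -> T -> trajectory G)
    (m : nat) (w : T) : seq (trajectory G) :=
  mkseq (fun i => W i w) m.

(* [W i] is the trajectory of the [i.+1]-th ball. The allocation is specified
   by the law of the process [W]: given the trajectories of the previous balls,
   the birthplace of the next one is uniform, and so is each of its moves among
   the tied candidates. *)
Definition local_search_allocation (R : realType) (d : measure_display)
    (T : measurableType d) (P : probability T R) (G : graph)
    (W : nat -> T -> trajectory G) : Prop :=
  (forall i p, measurable [set w | W i w = p]) /\
  (forall h : seq (trajectory G),
     P [set w | history W (size h) w = h] = (history_prob R [::] h)%:E).

Definition Tcov (R : realType) (G : graph) (T : Type)
    (W : nat -> T -> trajectory G) (w : T) : \bar R :=
  min_or_infty R [set m | forall v : G, (1 <= load (history W m w) v)%N].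

(* Main.v *)
Require Import Defs.
From mathcomp Require Import all_boot all_order all_algebra.
From mathcomp Require Import all_classical all_reals all_analysis.
From mathcomp Require Import ring lra.

(** Upper bound. Weigh the vertices by [K ^- d(u, v)]. While a ball moves, the
    load decreases by at least one per step, so [K ^- d(u, v) * K ^- load v] is
    at least as large at its endpoint as at its birthplace. Hence
    [prod_v (1 + a_t * K ^- d(u, v) * K ^- load v)], with a suitable [a_t], is a
    supermartingale, as it would be if every ball stayed at its birthplace.
    Loads of neighbours differ by at most one, so if [u] is uncovered then all
    the loads on the ball of radius [r] around [u] are at most [r]; this makes
    the product at least [K ^ (r |B_u^r|)], a large power of [n], and Markov's
    inequality applies.

    Lower bound. A ball that covers [u] is born in the ball of radius [r] around
    [u] or at a vertex [v] whose load is at least [d(u, v)]. The second event is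
    excluded as long as the sum of [K ^ (load v - d(u, v))] over the [v] outside
    that ball stays below [1]. This yields, for every [u], a nonnegative
    submartingale that vanishes at time [M] once [u] is covered,
    and that starts at [n ^ (- gamma / 4) / 2] or more. The sum of these processes
    over the set [S] has increments at most [n ^ (gamma / 4)] as long as the loads
    are small, so an exponential-moment (Azuma) argument shows that it is
    positive at time [M] except with superpolynomially small probability. *)

Set Implicit Arguments.
Unset Strict Implicit.
Unset Printing Implicit Defensive.

Import Order.TTheory GRing.Theory Num.Theory.

Local Open Scope classical_set_scope.
Local Open Scope ring_scope.

(** * Balls in a graph *)

Section Balls.
Variable G : graph.
Implicit Types u v w : G.

(** Balls grown one sphere at a time, for induction on the radius; [gballE] identifies them with
    [gball]. *)
Fixpoint nball u r : {set G} :=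
  if r is k.+1 then
    (nball u k :|: [set v | [exists w in nball u k, adj w v]])%SET
  else [set u]%SET.

Lemma nball_step u k v w : v \in nball u k -> adj v w -> w \in nball u k.+1.
Proof.
move=> vk vw; rewrite /= !inE; apply/orP; right; apply/existsP; exists v.
by rewrite vk.
Qed.

Lemma nball_le u j k v : (j <= k)%N -> v \in nball u j -> v \in nball u k.
Proof.
elim: k => [|k IH]; first by rewrite leqn0 => /eqP->.
rewrite leq_eqVlt => /predU1P[-> //|]; rewrite ltnS => /IH h /h vk.
by rewrite /= inE vk.
Qed.

Lemma nball_self u k : u \in nball u k.
Proof. by apply: (nball_le (leq0n k)); rewrite inE. Qed.

Lemma nball_path u j p v :
  v \in nball u j -> path (@adj G) v p -> last v p \in nball u (j + size p).
Proof.
elim: p j v => [|w p IH] j v /=; first by rewrite addn0.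
move=> vj /andP[vw pw]; rewrite addnS -addSn.
by apply: IH => //; exact: nball_step vj vw.
Qed.

Lemma nballP u k v :
  reflect (exists p, [/\ path (@adj G) u p, last u p = v & (size p <= k)%N])
          (v \in nball u k).
Proof.
apply: (iffP idP); last first.
  move=> [p [up <- sk]]; apply: (nball_le sk).
  by rewrite -[size p]add0n; apply: nball_path; rewrite ?inE.
elim: k v => [|k IH] v /=.
  by rewrite inE => /eqP->; exists [::].
rewrite !inE => /orP[/IH[p [h1 h2 h3]]|/existsP[w /andP[/IH[p [h1 h2 h3]] wv]]].
  by exists p; split => //; exact: leqW.
exists (rcons p v); split; rewrite ?last_rcons ?size_rcons //.
by rewrite rcons_path h1 h2.
Qed.

Lemma nball_sym u v k : (v \in nball u k) = (u \in nball v k).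
Proof.
suff imp a b : b \in nball a k -> a \in nball b k by apply/idP/idP; exact: imp.
move=> /nballP[p [h1 <- h3]]; apply/nballP; exists (rev (belast a p)).
rewrite rev_path size_rev size_belast; split => //.
  by rewrite (eq_path (e' := @adj G)) // => x y; rewrite adj_sym.
case: p {h1 h3} => [|x p] //=.
by rewrite rev_cons last_rcons.
Qed.

(** A path can be shortened to one without repeated vertices. This lets [dist_weight] range over
    radii below [#|G|] only. *)
Lemma nball_lt_card u k v :
  v \in nball u k -> exists2 j, (j < #|G|)%N & v \in nball u j.
Proof.
move=> /nballP[p [h1 h2 h3]].
move: h1 h2; case/shortenP => q uq uniq_q _ lq.
exists (size q); last by apply/nballP; exists q.
by have := max_card (mem (u :: q)); rewrite (card_uniqP uniq_q).
Qed.

Lemma card_nballS u k : (#|nball u k.+1| <= #|nball u k| * (max_degree G).+1)%N.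
Proof.
rewrite mulnS /=; apply: leq_trans (leq_card_setU _ _) _; rewrite leq_add2l.
have -> : [set v | [exists w in nball u k, adj w v]]%SET =
   finset.cover (imset (fun w => [set v | adj w v]%SET) (mem (nball u k))).
  rewrite cover_imset; apply/finset.setP => v; rewrite inE.
  apply/existsP/finset.bigcupP.
    by move=> [w /andP[h1 h2]]; exists w; rewrite ?inE.
  by move=> [w h1]; rewrite inE => h2; exists w; rewrite h1.
apply: leq_trans (leq_card_cover _) _.
apply: (@leq_trans (\sum_(A in imset (fun w : G => [set v | adj w v]%SET)
    (mem (nball u k)))
   max_degree G)%N).
  apply: leq_sum => A /imsetP[w _ ->]; exact: (@leq_bigmax _ (@degree G) w).
by rewrite sum_nat_const leq_mul2r leq_imset_card orbT.
Qed.

Lemma card_nball u k : (#|nball u k| <= (max_degree G).+1 ^ k)%N.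
Proof.
elim: k => [|k IH]; first by rewrite /= cards1.
apply: leq_trans (card_nballS u k) _.
by rewrite expnSr leq_mul2r IH orbT.
Qed.

(* If the ball of radius [r] is not the whole component, each of the first
   [r] spheres is nonempty. *)
Lemma card_nball_gt u v k r :
  v \in nball u k -> v \notin nball u r -> (r < #|nball u r|)%N.
Proof.
move=> vk; elim: r => [|r IH] vr; first by rewrite /= cards1.
have vr' : v \notin nball u r by apply: contra vr; exact: nball_le.
apply: leq_ltn_trans (IH vr') _; apply: proper_card; rewrite properE.
apply/andP; split; first by apply/fintype.subsetP => w; exact: nball_le.
apply/negP => /fintype.subsetP sub.
(* A ball that fails to grow once is closed under adjacency, so it contains the whole component. *)
have stable j w : w \in nball u j -> w \in nball u r.
  elim: j w => [|j IHj] w; first exact: nball_le.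
  rewrite /= !inE => /orP[/IHj //|/existsP[z /andP[/IHj zr zw]]].
  by apply: sub; exact: nball_step zr zw.
by rewrite (stable _ _ vk) in vr'.
Qed.

End Balls.

(** * Extended distances and balls *)

Section MinOrInfty.
Variable R : realType.

Lemma min_or_infty_lt (A : set nat) (x : R) :
  (min_or_infty R A < x%:E)%E -> exists2 m, A m & m%:R < x.
Proof.
by move/ereal_inf_lt => [_ [m Am <-]]; rewrite lte_fin; exists m.
Qed.

Lemma min_or_infty_le (A : set nat) m : A m -> (min_or_infty R A <= m%:R%:E)%E.
Proof. by move=> Am; apply: ereal_inf_lbound; exists m. Qed.

Lemma gballE (G : graph) (u : G) r : gball R u r = nball u r.
Proof.
apply/finset.setP => v; rewrite inE; apply/idP/nballP; last first.
  move=> [p [h1 h2 h3]]; apply: (@le_trans _ _ (size p)%:R%:E).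
    by apply: min_or_infty_le; exists p.
  by rewrite lee_fin ler_nat.
move=> h.
(* Only a strict bound on an infimum yields a witness, so [r] is relaxed to [r.+1]; integrality then
   restores [r]. *)
have : (gdist R u v < (r.+1)%:R%:E)%E.
  by apply: le_lt_trans h _; rewrite lte_fin ltr_nat.
move=> /min_or_infty_lt[m [p [h1 h2 h3]]]; rewrite ltr_nat ltnS => mr.
by exists p; rewrite h3.
Qed.

End MinOrInfty.

(** * Exponentially decaying distance weights *)

Section Weights.
Variables (R : realType) (G : graph).
Implicit Types u v w : G.

(* [K ^- d] at distance [d] from [u], and [0] in the other components. *)
Definition dist_weight (K : R) u v : R :=
  \big[Num.max/0]_(k < #|G| | v \in nball u k) K ^- k.

Variable K : R.
Hypothesis K1 : 1 <= K.

Let K0 : 0 < K. Proof. exact: lt_le_trans ltr01 K1. Qed.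

Lemma dist_weight_ge0 u v : 0 <= dist_weight K u v.
Proof. exact: bigmax_ge_id. Qed.

Lemma dist_weight_ge u v k : v \in nball u k -> K ^- k <= dist_weight K u v.
Proof.
move=> vk; have [j ltj vj] : exists2 j, (j < #|G|)%N & (j <= k)%N && (v \in nball u j).
  have [j ltj vj] := nball_lt_card vk.
  case: (leqP j k) => jk; first by exists j; rewrite ?jk.
  by exists k; rewrite ?leqnn //; exact: ltn_trans jk ltj.
case/andP: vj => jk vj.
apply: le_trans (_ : K ^- j <= _).
  by rewrite lef_pV2 ?posrE ?exprn_gt0 // ler_weXn2l.
exact: (@le_bigmax_cond _ _ _ _ (Ordinal ltj)
  (fun k : 'I_#|G| => v \in nball u k) (fun k : 'I_#|G| => K ^- k)).
Qed.

Lemma dist_weight_gt0 u v : 0 < dist_weight K u v ->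
  exists2 k, (k < #|G|)%N & (v \in nball u k) /\ dist_weight K u v = K ^- k.
Proof.
rewrite /dist_weight; elim/big_ind: _ => [|x y IHx IHy|k vk _].
- by rewrite ltxx.
- by rewrite maxEle; case: ifP => _; [exact: IHy|exact: IHx].
- by exists k.
Qed.

Lemma dist_weight_le1 u v : dist_weight K u v <= 1.
Proof.
apply: bigmax_le => // k _.
by rewrite invf_le1 ?exprn_gt0 // exprn_ege1.
Qed.

Lemma dist_weight_sym u v : dist_weight K u v = dist_weight K v u.
Proof. by rewrite /dist_weight; apply: eq_bigl => k; rewrite nball_sym. Qed.

(** The triangle inequality in multiplicative form: an edge changes the distance by at most one,
    hence the weight by at most a factor [K]. *)
Lemma dist_weight_path u v p : path (@adj G) v p ->
  dist_weight K u v <= K ^+ size p * dist_weight K u (last v p).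
Proof.
move=> vp; have := dist_weight_ge0 u v; rewrite le_eqVlt => /predU1P[<-|].
  by rewrite mulr_ge0 ?dist_weight_ge0 // exprn_ge0 // ltW.
move=> /dist_weight_gt0[k _ [vk ->]].
apply: le_trans (ler_wpM2l _ (dist_weight_ge (nball_path vk vp))).
  by rewrite exprD invfM mulrCA mulfV ?mulr1 // expf_neq0 // gt_eqF.
by rewrite exprn_ge0 // ltW.
Qed.

(* Summing over the balls rather than the spheres suffices. *)
Lemma sum_dist_weight u r (q : R) : 0 <= q -> q < 1 ->
  (max_degree G).+1%:R <= q * K ->
  \sum_(v | v \notin nball u r) dist_weight K u v <= q ^+ r.+1 / (1 - q).
Proof.
move=> q0 q1 hq.
(* A positive weight equals [K ^- k] for one radius [k] in the range, and that single summand
   suffices. The upper end leaves exactly [#|G|] terms after the shift by [r.+1]. *)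
have bnd v : v \notin nball u r -> dist_weight K u v <=
    \sum_(r.+1 <= k < #|G| + r.+1) (v \in nball u k)%:R * K ^- k.
  move=> vr; have := dist_weight_ge0 u v; rewrite le_eqVlt => /predU1P[<-|].
    by apply: sumr_ge0 => k _; rewrite mulr_ge0 // invr_ge0 exprn_ge0 // ltW.
  move=> /dist_weight_gt0[k kn [vk ->]].
  have rk : (r < k)%N by rewrite ltnNge; apply: contra vr => kr; exact: nball_le vk.
  rewrite (@big_cat_nat _ _ _ k) /=; [|done|exact: leq_trans (ltnW kn) (leq_addr _ _)].
  rewrite [X in _ + X]big_ltn; last exact: leq_trans kn (leq_addr _ _).
  rewrite vk mul1r addrCA lerDl.
  by rewrite addr_ge0 // sumr_ge0 // => i _; rewrite mulr_ge0 // invr_ge0 exprn_ge0 // ltW.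
apply: (@le_trans _ _ (\sum_(r.+1 <= k < #|G| + r.+1) q ^+ k)).
  apply: le_trans (ler_sum _ bnd) _.
  apply: (@le_trans _ _ (\sum_v \sum_(r.+1 <= k < #|G| + r.+1)
      (v \in nball u k)%:R * K ^- k)).
    rewrite [leRHS](bigID (fun v => v \notin nball u r)) /= lerDl sumr_ge0 // => v _.
    by apply: sumr_ge0 => k _; rewrite mulr_ge0 // invr_ge0 exprn_ge0 // ltW.
  rewrite exchange_big /=; apply: ler_sum => k _.
  rewrite -mulr_suml -natr_sum.
  have -> : (\sum_v (v \in nball u k) = #|nball u k|)%N.
    by rewrite -sum1_card [RHS]big_mkcond; apply: eq_bigr => v _; case: ifP.
  rewrite ler_pdivrMr ?exprn_gt0 // -exprMn.
  apply: le_trans (_ : (max_degree G).+1%:R ^+ k <= _).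
    by rewrite -natrX ler_nat card_nball.
  by rewrite lerXn2r ?nnegrE ?mulr_ge0 // ltW.
rewrite -{1}[r.+1]add0n big_addn addnK big_mkord ler_pdivlMr ?subr_gt0 //.
under eq_bigr do rewrite exprD.
rewrite -mulr_suml mulrAC mulrC ler_piMr ?exprn_ge0 //.
have -> : (\sum_(i < #|G|) q ^+ i) * (1 - q) = 1 - q ^+ #|G|.
  by rewrite -[RHS]opprB subrX1 mulrC -mulNr opprB.
by rewrite gerBl exprn_ge0.
Qed.

Lemma sum_dist_weight_le2 u : 2 * (max_degree G).+1%:R <= K ->
  \sum_v dist_weight K u v <= 2.
Proof.
move=> KD; rewrite (bigID (fun v => v \notin nball u 0)) /=.
rewrite [leRHS](_ : _ = 1 + 1) // lerD //.
  have half : 1 - 2^-1 = 2^-1 :> R by lra.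
  have half1 : 2^-1 < 1 :> R by lra.
  have half0 : 0 <= 2^-1 :> R by lra.
  have KD' : (max_degree G).+1%:R <= 2^-1 * K by lra.
  apply: le_trans (sum_dist_weight u 0 half0 half1 KD') _.
  by rewrite half expr1 divff // invr_eq0.
rewrite (eq_bigl (pred1 u)); last by move=> v; rewrite negbK inE.
rewrite big_pred1_eq; exact: dist_weight_le1.
Qed.

End Weights.

(** * Trajectories and supermartingales *)

Section Walks.
Variables (R : realType) (G : graph).
Implicit Types (x : G -> nat) (u v : G) (q : seq G) (p : G * seq G).

(** The properties of a trajectory of positive probability on which the estimates rest. The middle
    one records that the load drops by at least one per move. *)
Definition feasible x (p : trajectory G) : bool :=
  [&& path (@adj G) p.1 p.2, (x (endpoint p) + size p.2 <= x p.1)%N &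
      local_min x (endpoint p)].

Lemma walk_prob_ge0 x u q : 0 <= walk_prob R x u q.
Proof.
elim: q u => [|v q IH] u /=; first by rewrite ler0n.
by case: ifP => // _; rewrite mulr_ge0 ?invr_ge0 ?IH.
Qed.

Lemma walk_prob_feasible x u q : walk_prob R x u q != 0 -> feasible x (u, q).
Proof.
rewrite /feasible /endpoint /=; elim: q u => [|v q IH] u /=.
  by rewrite addn0 leqnn; case: local_min => //; rewrite eqxx.
rewrite inE; case: ifP => [/and3P[uv lt_vu _]|]; last by rewrite eqxx.
rewrite mulf_eq0 negb_or => /andP[_ /IH /and3P[-> h ->]].
by rewrite uv addnS /= andbT; exact: leq_ltn_trans h lt_vu.
Qed.

(** All lists of at most [k] vertices, adjacent or not: a finite support for the walks under loads
    at most [k]. *)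
Fixpoint walks k : seq (seq G) :=
  [::] :: if k is k'.+1 then [seq v :: q | v <- enum G, q <- walks k'] else [::].

Lemma walks_uniq k : uniq (walks k).
Proof.
elim: k => [|k IH] //=; apply/andP; split.
  by apply/negP => /allpairsP[[v q]] [].
apply: allpairs_uniq => //; first exact: enum_uniq.
by move=> [v q] [v' q'] /= _ _ [-> ->].
Qed.

Lemma local_minPn x u : local_min x u = (next_vertices x u == finset.set0).
Proof.
apply/idP/eqP => [/forallP h|h].
  apply/finset.setP => v; rewrite !inE; apply/negP => /and3P[uv lt_vu _].
  by have /implyP/(_ uv) := h v; rewrite leqNgt lt_vu.
apply/forallP => v; apply/implyP => uv; rewrite leqNgt; apply/negP => lt_vu.
have := @arg_minnP _ v (fun w => adj u w) x uv.
set w := [arg min_(w < v | _) _]%N => -[w' uw' min_w'].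
have : w' \in next_vertices x u.
  rewrite inE uw' (leq_ltn_trans (min_w' _ uv)) //=.
  by apply/forallP => z; apply/implyP => /min_w'.
by rewrite h inE.
Qed.

(** Every move lowers the load, so a ball makes at most [x u] moves and [walks k] carries the full
    mass. *)
Lemma sum_walk_prob x u k :
  (x u <= k)%N -> \sum_(q <- walks k) walk_prob R x u q = 1.
Proof.
elim: k u => [|k IH] u xu; rewrite big_cons /=.
  rewrite big_nil addr0; have -> : local_min x u; last by [].
  by apply/forallP => v; apply/implyP => _; move: xu; rewrite leqn0 => /eqP ->.
rewrite big_allpairs_dep /=.
have -> : \sum_(v <- enum G) \sum_(q <- walks k)
     (if v \in next_vertices x u
      then #|next_vertices x u|%:R^-1 * walk_prob R x v q else 0)
   = \sum_(v in next_vertices x u) #|next_vertices x u|%:R^-1.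
  rewrite big_enum /= [RHS]big_mkcond; apply: eq_bigr => v _.
  case: ifP => [vN|_]; last by rewrite big1.
  rewrite -mulr_sumr IH ?mulr1 //.
  by move: vN; rewrite inE => /and3P[_ /leq_trans/(_ xu)].
rewrite sumr_const local_minPn.
case: eqP => [->|/eqP]; first by rewrite finset.cards0 mulr0n addr0.
by rewrite -finset.card_gt0 => h; rewrite add0r -[LHS]mulr_natr mulVf // pnatr_eq0 -lt0n.
Qed.

Definition trajectories k : seq (G * seq G) :=
  [seq (u, q) | u <- enum G, q <- walks k].

Lemma trajectories_uniq k : uniq (trajectories k).
Proof.
apply: allpairs_uniq; [exact: enum_uniq|exact: walks_uniq|].
by move=> [v q] [v' q'] /= _ _ [-> ->].
Qed.

(** Once [F] is bounded through the birthplace alone, the walk probabilities sum to one and only a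
    uniform average over birthplaces remains. *)
Lemma mean_trajectories_le x k (F : trajectory G -> R) (c : G -> R) :
  (forall u, x u <= k)%N ->
  (forall p, feasible x p -> F p <= c p.1) ->
  \sum_(p <- trajectories k) trajectory_prob R x p * F p <=
  #|G|%:R^-1 * \sum_u c u.
Proof.
move=> xk Fc; rewrite big_allpairs_dep /= big_enum /= mulr_sumr.
apply: ler_sum => u _; apply: (@le_trans _ _
  (\sum_(q <- walks k) #|G|%:R^-1 * c u * walk_prob R x u q)); last first.
  by rewrite -mulr_sumr sum_walk_prob ?mulr1.
apply: ler_sum => q _; rewrite /trajectory_prob /=.
have [->|/walk_prob_feasible h] := eqVneq (walk_prob R x u q) 0.
  by rewrite !mulr0 mul0r.
rewrite -!mulrA ler_wpM2l ?invr_ge0 //.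
by rewrite mulrC ler_wpM2r ?walk_prob_ge0 //; exact: (Fc (u, q)).
Qed.

Lemma sum_trajectory_prob x k : (0 < #|G|)%N -> (forall u, x u <= k)%N ->
  \sum_(p <- trajectories k) trajectory_prob R x p = 1.
Proof.
move=> G0 xk; rewrite big_allpairs_dep /= big_enum /=.
under eq_bigr do rewrite -mulr_sumr sum_walk_prob // mulr1.
by rewrite sumr_const -[_ *+ _]mulr_natr mulVf // pnatr_eq0 -lt0n.
Qed.

Lemma load_rcons (h : seq (trajectory G)) (p : trajectory G) v :
  load (rcons h p) v = (load h v + (endpoint p == v))%N.
Proof. by rewrite /load -cats1 count_cat /= addn0. Qed.

Lemma load_le_size (h : seq (trajectory G)) v : (load h v <= size h)%N.
Proof. exact: count_size. Qed.

Lemma trajectory_prob_ge0 x (p : trajectory G) : 0 <= trajectory_prob R x p.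
Proof. by rewrite mulr_ge0 ?invr_ge0 ?walk_prob_ge0. Qed.

Lemma history_prob_ge0 (past h : seq (trajectory G)) : 0 <= history_prob R past h.
Proof.
elim: h past => [|p h IH] past //=.
by rewrite mulr_ge0 ?trajectory_prob_ge0.
Qed.

Lemma history_prob_rcons (past h : seq (trajectory G)) p :
  history_prob R past (rcons h p) =
  history_prob R past h * trajectory_prob R (load (past ++ h)) p.
Proof.
elim: h past => [|p' h IH] past /=; first by rewrite cats0 mulr1 mul1r.
by rewrite IH mulrA cat_rcons.
Qed.

End Walks.

(** * The allocation as a random process *)

Section Process.
Variables (R : realType) (G : graph) (d : measure_display)
  (T : measurableType d) (P : probability T R) (W : nat -> T -> trajectory G).
Hypothesis WP : local_search_allocation P W.
Implicit Types h : seq (trajectory G).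

#[local] Arguments history {G T} W m w : simpl never.

Lemma historyS m w : history W m.+1 w = rcons (history W m w) (W m w).
Proof. by rewrite /history /mkseq -addn1 iotaD map_cat /= cats1. Qed.

Lemma size_history m w : size (history W m w) = m.
Proof. exact: size_mkseq. Qed.

Lemma measurable_history_eq m h : measurable [set w | history W m w = h].
Proof.
elim: m h => [|m IH] h.
  have [->|hn] := eqVneq (h : seq (G * seq G)) [::].
    by rewrite (_ : mkset _ = setT) //; apply/seteqP; split.
  rewrite (_ : mkset _ = set0) //; apply/seteqP; split => // w /=.
  by move=> e; rewrite -e eqxx in hn.
case/lastP: h => [|h p].
  by rewrite (_ : mkset _ = set0) //; apply/seteqP; split => // w /=.
rewrite (_ : mkset _ = [set w | history W m w = h] `&` [set w | W m w = p]).
  by apply: measurableI; [exact: IH|exact: WP.1].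
apply/seteqP; split => w /=; rewrite historyS; first by move=> /rcons_inj[-> ->].
by move=> [-> ->].
Qed.

Lemma measurable_countable_event (S : countType) (X : T -> S) (E : set S) :
  (forall x, measurable [set w | X w = x]) -> measurable [set w | E (X w)].
Proof.
move=> mX; rewrite (_ : mkset _ = \bigcup_x ([set w | X w = x] `&` [set _ | E x])).
  apply: countable_bigcupT_measurable; first exact: countableP.
  move=> x; apply: measurableI; first exact: mX.
  by have [e|e] := pselect (E x); [rewrite (_ : mkset _ = setT)|rewrite (_ : mkset _ = set0)];
    rewrite //; apply/seteqP; split.
apply/seteqP; split => w /=; first by exists (X w).
by move=> [x _ [-> ]].
Qed.

Lemma measurable_history m (E : set (seq (trajectory G))) :
  measurable [set w | E (history W m w)].
Proof.
apply: (@measurable_countable_event (seq (G * seq G))%type (history W m)).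
exact: measurable_history_eq.
Qed.

Lemma measurable_trajectory m (E : set (trajectory G)) :
  measurable [set w | E (W m w)].
Proof.
apply: (@measurable_countable_event (G * seq G)%type (W m)); exact: WP.1.
Qed.

(** Trajectories form an infinite type; a finite list with a remainder avoids infinite sums, and the
    remainder is later shown to be null. *)
Lemma measure_split_trajectory (D : set T) m (s : seq (G * seq G)) :
  measurable D -> uniq s ->
  P D = (\sum_(p <- s) P (D `&` [set w | W m w = p]) +
         P (D `&` [set w | (W m w : G * seq G) \notin s]))%E.
Proof.
move=> mD; elim: s => [|p s IH] /=.
  by rewrite big_nil add0e (_ : mkset _ = setT) ?setIT //; apply/seteqP; split.
move=> /andP[ps us]; rewrite big_cons (IH us) [LHS]addeC [RHS]addeAC; congr (_ + _)%E.
rewrite [RHS]addeC.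
pose A (s : seq (G * seq G)) := [set w | (W m w : G * seq G) \notin s].
have mA s' : measurable (D `&` A s').
  apply: measurableI => //.
  exact: (@measurable_trajectory m (fun p => (p : G * seq G) \notin s')).
rewrite -/(A s) -/(A (p :: s)) (measureDI P (mA s) (WP.1 m p)); congr (P _ + P _)%E.
  apply/seteqP; split => w; rewrite /A /= inE negb_or.
    by move=> [[Dw sw] /eqP pw]; rewrite sw andbT.
  by move=> [Dw /andP[/eqP pw sw]].
apply/seteqP; split => w; rewrite /A /=; first by move=> [[]].
by move=> [Dw pw]; rewrite pw.
Qed.

(* A Markov inequality for nonnegative supermartingales. The one-step
   condition only compares [Phi] with a bound [c] that depends on the
   birthplace of the next ball. *)
Lemma supermartingale_bound (Inv E : set (seq (trajectory G)))
    (Phi : seq (trajectory G) -> R) m :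
  (0 < #|G|)%N ->
  Inv [::] ->
  (forall h p, Inv h -> feasible (load h) p -> Inv (rcons h p)) ->
  (forall h, 0 <= Phi h) ->
  (forall h, Inv h -> (size h < m)%N -> exists2 c : G -> R,
     forall p, feasible (load h) p -> Phi (rcons h p) <= c p.1 &
     #|G|%:R^-1 * \sum_u c u <= Phi h) ->
  (forall h, Inv h -> size h = m -> E h -> 1 <= Phi h) ->
  (P [set w | E (history W m w)] <= (Phi [::])%:E)%E.
Proof.
move=> G0 Inv0 InvS Phi0 step PhiE.
have PH h : P [set w | history W (size h) w = h] = (history_prob R [::] h)%:E.
  exact: WP.2.
pose A := [set w | E (history W m w)].
have mA : measurable A by exact: measurable_history.
(* Backward induction on the number [i] of balls still to come, conditioning on the history [h]; the
   empty history gives the goal. *)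
suff claim i h : (i + size h = m)%N -> Inv h ->
    (P ([set w | history W (size h) w = h] `&` A) <=
     (history_prob R [::] h * Phi h)%:E)%E.
  have := claim m [::] (addn0 m) Inv0; rewrite /= mul1r; congr (P _ <= _)%E.
  by rewrite (_ : mkset _ = setT) ?setTI //; apply/seteqP; split.
elim: i h => [|i IH] h /= hm Inv_h.
  have [Eh|Eh] := pselect (E h).
    apply: (@le_trans _ _ (P [set w | history W (size h) w = h])).
      apply: le_measure; rewrite ?inE; [|exact: measurable_history_eq|by move=> w []].
      by apply: measurableI => //; exact: measurable_history_eq.
    by rewrite PH lee_fin ler_peMr ?history_prob_ge0 // PhiE.
  rewrite (_ : _ `&` _ = set0) ?measure0 ?lee_fin ?mulr_ge0 ?history_prob_ge0 //.
  apply/seteqP; split => // w [/= wh]; rewrite /A /= -hm wh; exact: Eh.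
set D := [set w | history W (size h) w = h].
have mD : measurable D by exact: measurable_history_eq.
have Dp p : D `&` [set w | W (size h) w = p] =
    [set w | history W (size (rcons h p)) w = rcons h p].
  apply/seteqP; split => w; rewrite /D /= size_rcons historyS.
    by move=> [-> ->].
  by move=> /rcons_inj[-> ->].
have loadh u : (load h u <= m)%N.
  by apply: leq_trans (load_le_size h u) _; rewrite -hm leq_addl.
have uT := trajectories_uniq G m.
(* The listed trajectories already have total conditional probability one. *)
have nullT : P (D `&` [set w | (W (size h) w : G * seq G) \notin trajectories G m]) = 0%E.
  have := measure_split_trajectory (size h) mD uT.
  under eq_bigr do rewrite Dp PH history_prob_rcons /=.
  rewrite sumEFin -mulr_sumr sum_trajectory_prob // mulr1 /D PH.
  set r := P _; have : (0 <= r)%E by exact: measure_ge0.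
  case: r => [r||] //=.
  rewrite -EFinD => r0 [] /eqP; rewrite -subr_eq0 opprD addrA subrr sub0r oppr_eq0.
  by move=> /eqP ->.
rewrite (measure_split_trajectory (size h) (measurableI _ _ mD mA) uT).
rewrite [X in (_ + X)%E](_ : _ = 0%E) ?adde0; last first.
  apply/eqP; rewrite eq_le measure_ge0 andbT -nullT le_measure ?inE //.
  - apply: measurableI; first exact: measurableI.
    exact: (@measurable_trajectory _ (fun p => (p : G * seq G) \notin trajectories G m)).
  - apply: measurableI => //.
    exact: (@measurable_trajectory _ (fun p => (p : G * seq G) \notin trajectories G m)).
  - by move=> w [[]].
have szh : (size h < m)%N by rewrite -hm addSn ltnS leq_addl.
have [c Phic cPhi] := step h Inv_h szh.
apply: (@le_trans _ _ (\sum_(p <- trajectories G m)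
   (history_prob R [::] h * (trajectory_prob R (load h) p * Phi (rcons h p)))%:E)%E).
  apply: lee_sum => p _.
  rewrite setIAC Dp.
  (* [Inv] is only known to persist along feasible trajectories; those of probability zero
     contribute nothing and are treated apart. *)
  have [p0|p0] := eqVneq (trajectory_prob R (load h) p) 0.
    rewrite p0 mul0r mulr0.
    have := PH (rcons h p); rewrite history_prob_rcons /= p0 mulr0 => <-.
    by rewrite le_measure ?inE //; [apply: measurableI|]; try exact: measurable_history_eq.
  apply: le_trans (IH _ _ _) _.
  - by rewrite size_rcons addnS -addSn.
  - apply: InvS => //; case: p p0 => u q; rewrite mulf_eq0 negb_or => /andP[_].
    exact: walk_prob_feasible.
  - by rewrite history_prob_rcons /= mulrA.
rewrite sumEFin lee_fin -mulr_sumr ler_wpM2l ?history_prob_ge0 //.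
exact: le_trans (mean_trajectories_le loadh Phic) cPhi.
Qed.

End Process.

(** * Covering every vertex *)

Section LoadFacts.
Variables (R : realType) (G : graph).
Implicit Types (u v : G) (h : seq (trajectory G)) (x : G -> nat).

Definition smooth x : Prop := forall u v, adj u v -> (x u <= (x v).+1)%N.

(** The ball stops at a local minimum, so raising the load there by one cannot open a gap of two. *)
Lemma smooth_rcons h p :
  smooth (load h) -> feasible (load h) p -> smooth (load (rcons h p)).
Proof.
move=> sm /and3P[_ _ /forallP lm] u v uv; rewrite !load_rcons.
have := sm u v uv; case: eqP => [e|_]; case: eqP => [e'|_]; rewrite ?addn0 ?addn1 //.
  have := lm v; rewrite e uv /= => h1 _; exact: h1.
by move/leqW.
Qed.

Lemma smooth_nball x u v k : smooth x -> v \in nball u k -> (x v <= x u + k)%N.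
Proof.
move=> sm; elim: k v => [|k IH] v; first by rewrite inE addn0 => /eqP->.
rewrite /= !inE => /orP[/IH h|/existsP[w /andP[/IH h wv]]].
  by rewrite addnS; exact: leqW.
by rewrite addnS; apply: leq_trans (sm v w _) _; rewrite ?ltnS // adj_sym.
Qed.

(** A move away from [u] costs at most a factor [K] in the distance weight, and the drop of the load
    gives back at least as much. *)
Lemma feasible_dist_weight (K : R) x u (p : trajectory G) : 1 <= K -> feasible x p ->
  dist_weight K u p.1 * K ^- x p.1 <= dist_weight K u (endpoint p) * K ^- x (endpoint p).
Proof.
move=> K1 /and3P[pp xp _]; have K0 : 0 < K by exact: lt_le_trans K1.
rewrite ler_pdivrMr ?exprn_gt0 // mulrAC ler_pdivlMr ?exprn_gt0 //.
apply: le_trans (ler_wpM2r _ (dist_weight_path K1 u pp)) _.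
  by rewrite exprn_ge0 // ltW.
rewrite -/(endpoint p) mulrC mulrA [leRHS]mulrC ler_wpM2r ?dist_weight_ge0 //.
by rewrite -exprD ler_weXn2l.
Qed.

End LoadFacts.

(** The Weierstrass product inequality; the induction also carries that the product lies between [0]
    and [1]. *)
Lemma prod_1B_ge (R : realDomainType) (I : Type) (r : seq I) (y : I -> R) :
  (forall i, 0 <= y i <= 1) ->
  1 - \sum_(i <- r) y i <= \prod_(i <- r) (1 - y i).
Proof.
move=> y01; suff : 1 - \sum_(i <- r) y i <= \prod_(i <- r) (1 - y i) /\
   0 <= \prod_(i <- r) (1 - y i) <= 1 by case.
elim: r => [|i r [IH1 /andP[IH2 IH3]]]; first by rewrite !big_nil subr0 ler01 lexx.
rewrite !big_cons; have /andP[y0 y1] := y01 i; split.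
  by nra.
by apply/andP; split; nra.
Qed.

(** * The potential for uncovered vertices *)

Section CoverUpperBound.
Variables (R : realType) (G : graph) (K : R) (r C0 : nat).
Hypothesis G0 : (0 < #|G|)%N.
Hypothesis KD : 2 * (max_degree G).+1%:R <= K.
Hypothesis KC : K ^+ 3 <= expR (C0%:R / 2).
Hypothesis hr : forall u : G, ln (#|G|%:R : R) <= r%:R * #|nball u r|%:R.
Implicit Types (u v : G) (h : seq (trajectory G)).

Let m := (C0 * r * #|G|)%N.
Let n : R := #|G|%:R.
Let c : R := 1 - K^-1.

Let K2 : 2 <= K.
Proof. by apply: le_trans KD; rewrite ler_peMr // ler1n. Qed.
Let K1 : 1 <= K. Proof. by apply: le_trans K2; rewrite ler1n. Qed.
Let K0 : 0 < K. Proof. exact: lt_le_trans K1. Qed.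
Let n1 : 1 <= n. Proof. by rewrite ler1n. Qed.
Let n0 : 0 < n. Proof. exact: lt_le_trans n1. Qed.
Let KV0 : 0 < K^-1. Proof. by rewrite invr_gt0. Qed.
Let c_ge : 2^-1 <= c.
Proof. have : K^-1 <= 2^-1 by rewrite lef_pV2 ?posrE. by rewrite /c; lra. Qed.
Let c_le : c <= 1. Proof. have := KV0; rewrite /c; lra. Qed.
Let cn0 : 0 <= c / n. Proof. by rewrite divr_ge0 // ltW // (lt_le_trans _ c_ge). Qed.
Let cn1 : c / n <= 1. Proof. by rewrite ler_pdivrMr // mul1r (le_trans c_le). Qed.

(** The coefficient grows by [1 / (1 - c / n)] per ball, offsetting the mean decrease of the
    product; [c] is the relative loss of [K ^- load] when a load rises by one. It ends at
    [K ^ (3 * r)]. *)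
Definition cover_potential u h : R :=
  \prod_v (1 + (1 - c / n) ^+ (m - size h) * K ^+ (3 * r) *
               (dist_weight K u v * K ^- load h v)).

Let weight_ge0 u h v : 0 <= dist_weight K u v * K ^- load h v.
Proof. by rewrite mulr_ge0 ?dist_weight_ge0 // invr_ge0 exprn_ge0 // ltW. Qed.

Let coef_ge0 k : 0 <= (1 - c / n) ^+ k * K ^+ (3 * r).
Proof. by rewrite mulr_ge0 // exprn_ge0 ?subr_ge0 // ltW. Qed.

Lemma cover_potential_ge0 u h : 0 <= cover_potential u h.
Proof.
by apply: prodr_ge0 => v _; rewrite addr_ge0 // mulr_ge0.
Qed.

(* The next ball multiplies the factor of its endpoint by
   [1 - c y / (1 + y)], which is at most the same quantity for its birthplace. *)
Lemma cover_potential_step u h : (size h < m)%N -> exists2 b : G -> R,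
  forall p, feasible (load h) p -> cover_potential u (rcons h p) <= b p.1 &
  n^-1 * \sum_v b v <= cover_potential u h.
Proof.
move=> hm; set k := (m - size (rcons h (u, [::] : seq G)))%N.
have ksz p : (m - size (rcons h p))%N = k by rewrite /k !size_rcons.
have kS : (m - size h)%N = k.+1 by rewrite /k size_rcons subnSK.
pose a := (1 - c / n) ^+ k * K ^+ (3 * r).
have a0 : 0 <= a by exact: coef_ge0.
pose y v := a * (dist_weight K u v * K ^- load h v).
have y0 v : 0 <= y v by rewrite mulr_ge0.
have y1 v : 0 < 1 + y v by rewrite ltr_pwDl.
pose B := \prod_v (1 + y v).
have B0 : 0 <= B by apply: prodr_ge0 => v _; exact: ltW.
pose f v := y v / (1 + y v).
have f01 v : 0 <= f v <= 1.
  rewrite /f divr_ge0 //=; last exact: ltW.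
  by rewrite ler_pdivrMr // mul1r lerDr.
exists (fun v => B * (1 - c * f v)).
  move=> p fp; set w := endpoint p.
  have yw : y p.1 <= y w by rewrite ler_wpM2l // feasible_dist_weight.
  have fw : f p.1 <= f w.
    rewrite /f ler_pdivrMr // mulrAC ler_pdivlMr // !mulrDr !mulr1 [y w * _]mulrC.
    by rewrite lerD2r.
  apply: (@le_trans _ _ (B * (1 - c * f w))); last first.
    by rewrite ler_wpM2l // lerB // ler_wpM2l // (le_trans _ c_ge).
  have -> : cover_potential u (rcons h p) =
      \prod_v (1 + a * (dist_weight K u v * K ^- load (rcons h p) v)).
    by rewrite /cover_potential ksz.
  rewrite (bigD1 w) //= /B [in leRHS](bigD1 w) //=.
  rewrite load_rcons eqxx addn1 [leRHS]mulrAC le_eqVlt; apply/predU1P; left.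
  congr (_ * _).
    have y1w := lt0r_neq0 (y1 w); have K0w := lt0r_neq0 K0.
    have -> : a * (dist_weight K u w * K ^- (load h w).+1) = y w * K^-1.
      by rewrite /y exprS invfM; ring.
    by rewrite /f /c; field; rewrite y1w K0w.
  by apply: eq_bigr => v vw; rewrite load_rcons eq_sym (negbTE vw) addn0.
(* The coefficient before the step is [1 - c / n] times the one after it, so a factor
   [1 - c / n * f v] splits off exactly. *)
have -> : cover_potential u h = B * \prod_v (1 - c / n * f v).
  rewrite /cover_potential /B -big_split /=; apply: eq_bigr => v _.
  have alg (t z : R) : 1 + z != 0 -> 1 + (1 - t) * z = (1 + z) * (1 - t * (z / (1 + z))).
    by move=> ?; field.
  by rewrite /f -alg ?lt0r_neq0 // kS exprS /y /a; ring.
rewrite -mulr_sumr mulrCA ler_wpM2l //.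
apply: le_trans (_ : 1 - \sum_v c / n * f v <= _); last first.
  apply: prod_1B_ge => v; have /andP[f0 f1] := f01 v.
  by rewrite mulr_ge0 //= mulr_ile1.
have -> : \sum_v (1 - c * f v) = n - c * \sum_v f v.
  by rewrite sumrB -mulr_sumr sumr_const.
by rewrite mulrBr mulVf ?gt_eqF // -mulr_sumr mulrA [n^-1 * c]mulrC.
Qed.

(** The initial coefficient is at most [1]: [m * c / n] is at least [C0 * r / 2], which dominates
    [3 * r * ln K] by [KC]. The product is then at most the exponential of the total weight. *)
Lemma cover_potential_nil u : cover_potential u [::] <= expR 2.
Proof.
apply: (@le_trans _ _ (\prod_v expR (dist_weight K u v))).
  apply: ler_prod => v _.
  have cw := mulr_ge0 (coef_ge0 (m - 0)) (weight_ge0 u [::] v).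
  rewrite addr_ge0 //=.
  apply: le_trans (expR_ge1Dx _); rewrite lerD2l expr0 invr1 mulr1.
  rewrite ler_piMl ?dist_weight_ge0 // subn0.
  apply: (@le_trans _ _ (expR (- (c / n)) ^+ m * K ^+ (3 * r))).
    rewrite ler_wpM2r ?exprn_ge0 ?(ltW K0) // lerXn2r ?nnegrE ?subr_ge0 ?expR_ge0 //.
    by have := expR_ge1Dx (- (c / n)).
  rewrite -expRM_natl exprM.
  apply: (@le_trans _ _ (expR (m%:R * (- (c / n))) * expR (C0%:R / 2) ^+ r)).
    rewrite ler_wpM2l ?expR_ge0 // lerXn2r ?nnegrE ?expR_ge0 ?exprn_ge0 //.
    exact: ltW.
  rewrite -expRM_natl -expRD -[leRHS]expR0 ler_expR /m !natrM -/n.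
  have -> : C0%:R * r%:R * n * - (c / n) + r%:R * (C0%:R / 2) =
     C0%:R * r%:R * (2^-1 - c).
    by field; rewrite gt_eqF.
  by rewrite mulr_ge0_le0 // subr_le0.
by rewrite -expR_sum ler_expR sum_dist_weight_le2.
Qed.

(** Within distance [r] of [u], distance and load each take away at most a factor [K ^ r] from
    [K ^ (3 * r)]. A factor [K ^ r] remains for every vertex of the ball, and [hr] turns the product
    into a power of [n]. *)
Lemma cover_potential_end u h : smooth (load h) -> size h = m -> load h u = 0%N ->
  n `^ ln K <= cover_potential u h.
Proof.
move=> sm hm hu; apply: (@le_trans _ _ (K ^+ (r * #|nball u r|))).
  rewrite /powR gt_eqF // -[K in leRHS]lnK ?posrE // -expRM_natl ler_expR mulrC.
  by rewrite ler_wpM2r ?ln_ge0 // natrM.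
rewrite /cover_potential hm subnn expr0 mul1r.
rewrite (bigID (fun v => v \in nball u r)) /= exprM -[leLHS]mulr1.
have ge1 v : 1 <= 1 + K ^+ (3 * r) * (dist_weight K u v * K ^- load h v).
  by rewrite lerDl mulr_ge0 // exprn_ge0 // ltW.
rewrite ler_pM ?exprn_ge0 ?(ltW K0) //; last first.
  by elim/big_ind: _ => // x y x1 y1; rewrite -[leLHS]mulr1 ler_pM.
rewrite -prodr_const; apply: ler_prod => v vr; rewrite exprn_ge0 ?(ltW K0) //=.
apply: (@le_trans _ _ (K ^+ (3 * r) * (K ^- r * K ^- r))).
  have Kr : K ^+ r != 0 by rewrite expf_neq0 // gt_eqF.
  rewrite mulSn mulSn mul1n !exprD.
  by rewrite le_eqVlt; apply/predU1P; left; field.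
apply: (@le_trans _ _ (K ^+ (3 * r) * (dist_weight K u v * K ^- load h v))); last first.
  by rewrite lerDr.
rewrite ler_wpM2l ?exprn_ge0 ?(ltW K0) // ler_pM ?invr_ge0 ?exprn_ge0 ?(ltW K0) //.
  exact: dist_weight_ge.
rewrite lef_pV2 ?posrE ?exprn_gt0 // ler_weXn2l //.
by have := smooth_nball sm vr; rewrite hu.
Qed.

(** Summing the potentials over [u] acts as a union bound. *)
Lemma uncovered_prob_le (d : measure_display) (T : measurableType d)
    (P : probability T R) (W : nat -> T -> trajectory G) :
  local_search_allocation P W ->
  (P [set w | exists u, load (history W m w) u = 0%N] <=
   (n * expR 2 / n `^ ln K)%:E)%E.
Proof.
move=> WP; have L0 : 0 < n `^ ln K by exact: powR_gt0.
pose Phi h := (n `^ ln K)^-1 * \sum_u cover_potential u h.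
apply: le_trans (supermartingale_bound WP (Inv := fun h => smooth (load h))
   (E := fun h => exists u, load h u = 0%N) (Phi := Phi) G0 _ _ _ _ _) _.
- by [].
- by move=> h p; exact: smooth_rcons.
- move=> h; rewrite mulr_ge0 ?invr_ge0 ?(ltW L0) // sumr_ge0 // => u _.
  exact: cover_potential_ge0.
- move=> h _ hm.
  have [b b1 b2] : {b : G -> G -> R | forall u p, feasible (load h) p ->
     cover_potential u (rcons h p) <= b u p.1 &
     forall u, n^-1 * \sum_v b u v <= cover_potential u h}.
    have /choice[b bP] u : exists b : G -> R, (forall p, feasible (load h) p ->
      cover_potential u (rcons h p) <= b p.1) /\
      n^-1 * \sum_v b v <= cover_potential u h.
      by have [b ? ?] := cover_potential_step u hm; exists b.
    by exists b => u; have [] := bP u.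
  exists (fun v => (n `^ ln K)^-1 * \sum_u b u v).
    move=> p fp; rewrite ler_wpM2l ?invr_ge0 ?(ltW L0) //.
    by apply: ler_sum => u _; exact: b1.
  rewrite -mulr_sumr mulrCA ler_wpM2l ?invr_ge0 ?(ltW L0) //.
  by rewrite exchange_big mulr_sumr /=; apply: ler_sum => u _; exact: b2.
- move=> h sm hm [u hu]; rewrite /Phi mulrC ler_pdivlMr // mul1r.
  apply: le_trans (cover_potential_end sm hm hu) _.
  rewrite (bigD1 u) //= lerDl sumr_ge0 // => v _; exact: cover_potential_ge0.
rewrite lee_fin /Phi mulrC ler_wpM2r ?invr_ge0 ?(ltW L0) //.
apply: le_trans (ler_sum _ (fun u _ => cover_potential_nil u)) _.
by rewrite sumr_const -[leLHS]mulr_natl.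
Qed.

End CoverUpperBound.

(** * Leaving a vertex uncovered *)

(** Inverting [1 + y <= expR y] suffices, as [(1 + y) * (1 - y + 2 * y ^ 2) = 1 + y ^ 2 * (1 + 2 *
    y)] is at least [1]. *)
Lemma expRN_le (R : realType) (y : R) : `|y| <= 2^-1 ->
  expR (- y) <= 1 - y + 2 * y ^+ 2.
Proof.
rewrite ler_norml => /andP[y1 y2].
have h := expR_ge1Dx y.
rewrite expRN invf_ple ?posrE ?expR_gt0 //; last by nra.
apply: le_trans h; rewrite -div1r ler_pdivrMr; last by nra.
by nra.
Qed.

(** * Tail of the maximum load *)

Section MaxLoad.
Variables (R : realType) (G : graph) (K : R).
Hypothesis G0 : (0 < #|G|)%N.
Hypothesis K1 : 1 <= K.
Implicit Types (u v : G) (h : seq (trajectory G)).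

Let n : R := #|G|%:R.
Let n0 : 0 < n. Proof. by rewrite ltr0n. Qed.
Let K0 : 0 < K. Proof. exact: lt_le_trans K1. Qed.

(** A ball ends at a load no larger than that of its birthplace, so the sum of the [K ^ load] grows
    in mean by at most the factor [s] per ball. *)
Lemma max_load_prob_le (d : measure_display) (T : measurableType d)
    (P : probability T R) (W : nat -> T -> trajectory G) (M L : nat) :
  local_search_allocation P W ->
  (P [set w | exists u, (L < load (history W M w) u)%N] <=
   (n * expR ((K - 1) * (M%:R / n)) / K ^+ L.+1)%:E)%E.
Proof.
move=> WP; pose s := 1 + (K - 1) / n.
have s1 : 1 <= s by rewrite lerDl divr_ge0 ?subr_ge0 // ltW.
have s0 : 0 <= s by exact: le_trans s1.
have KL : 0 < K ^+ L.+1 by rewrite exprn_gt0.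
pose Phi h := s ^+ (M - size h) * (\sum_v K ^+ load h v) / K ^+ L.+1.
apply: le_trans (supermartingale_bound WP (Inv := fun => True)
   (E := fun h => exists u, (L < load h u)%N) (Phi := Phi) G0 _ _ _ _ _) _.
- by [].
- by [].
- move=> h; rewrite divr_ge0 ?(ltW KL) // mulr_ge0 ?exprn_ge0 // sumr_ge0 // => v _.
  by rewrite exprn_ge0 // ltW.
- move=> h _ hm; set k := (M - (size h).+1)%N.
  have kS : (M - size h)%N = k.+1 by rewrite subnSK.
  set A := \sum_v K ^+ load h v.
  exists (fun v => s ^+ k * (A + (K - 1) * K ^+ load h v) / K ^+ L.+1).
    move=> p /and3P[_ fp _]; rewrite /Phi size_rcons -/k.
    rewrite ler_wpM2r ?invr_ge0 ?(ltW KL) // ler_wpM2l ?exprn_ge0 //.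
    set w := endpoint p in fp *.
    have -> : \sum_v K ^+ load (rcons h p) v = A + (K - 1) * K ^+ load h w.
      rewrite /A !(bigD1 w (P := xpredT)) //= load_rcons eqxx addn1 exprS.
      rewrite (eq_bigr (fun v => K ^+ load h v)); first ring.
      by move=> v vw; rewrite load_rcons eq_sym (negbTE vw) addn0.
    rewrite lerD2l ler_wpM2l ?subr_ge0 // ler_weXn2l //.
    exact: leq_trans (leq_addr _ _) fp.
  rewrite /Phi kS -/A -mulr_suml -mulr_sumr big_split /= -mulr_sumr -/A sumr_const.
  rewrite -[A *+ _]mulr_natl -/n mulrA ler_wpM2r ?invr_ge0 ?(ltW KL) //.
  rewrite le_eqVlt; apply/predU1P; left; rewrite exprS /s; field.
  by rewrite gt_eqF.
- move=> h _ hm [u hu]; rewrite /Phi hm subnn mul1r ler_pdivlMr // mul1r.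
  rewrite (bigD1 u) //=; apply: (@le_trans _ _ (K ^+ load h u)).
    by rewrite ler_weXn2l.
  by rewrite lerDl sumr_ge0 // => v _; rewrite exprn_ge0 // ltW.
rewrite lee_fin /Phi subn0 ler_wpM2r ?invr_ge0 ?(ltW KL) //.
rewrite sumr_const mulrC ler_wpM2l ?(ltW n0) //.
rewrite (_ : (K - 1) * (M%:R / n) = M%:R * ((K - 1) / n)); last by ring.
rewrite expRM_natl lerXn2r ?nnegrE ?expR_ge0 //; exact: expR_ge1Dx.
Qed.

End MaxLoad.

(** * Survival processes of uncovered vertices *)

Section CoverLowerBound.
Variables (R : realType) (G : graph) (K : R) (S : {set G}) (r M : nat).
Hypothesis G0 : (0 < #|G|)%N.
Hypothesis K1 : 1 <= K.
Hypothesis hS : forall u, u \in S -> 2 * #|nball u r|%:R <= (#|G|%:R : R).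
Implicit Types (u v w : G) (h : seq (trajectory G)) (p : trajectory G).

Let n : R := #|G|%:R.
Let n0 : 0 < n. Proof. by rewrite ltr0n. Qed.
Let K0 : 0 < K. Proof. exact: lt_le_trans K1. Qed.
(* [beta u <= 1/2] gives [(K - 1) / (n (1 - beta u)) <= delta], so the growth by
   [1 + delta] dominates the expected growth of the far energy conditionally on
   no birth near [u]. *)
Let delta : R := 2 * (K - 1) / n.
Let delta0 : 0 <= delta.
Proof. by rewrite divr_ge0 ?(ltW n0) // mulr_ge0 ?subr_ge0. Qed.
Let growth_ge0 k : 0 <= (1 + delta) ^+ k.
Proof. by rewrite exprn_ge0 // addr_ge0. Qed.
Let Kpow_ge0 k : 0 <= K ^+ k.
Proof. by rewrite exprn_ge0 // ltW. Qed.
Let beta u : R := #|nball u r|%:R / n.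
Let beta0 u : 0 <= beta u. Proof. by rewrite divr_ge0 ?(ltW n0). Qed.
Let beta1 u : u \in S -> beta u <= 2^-1.
Proof. by move=> /hS h; rewrite /beta ler_pdivrMr // -/n; move: h; rewrite -/n; lra. Qed.

Definition born_near u h := has (fun p => p.1 \in nball u r) h.

(** At least [1] as soon as a far vertex in the component of [u] has a load no smaller than its
    distance to [u]. *)
Definition far_energy u h : R :=
  \sum_(v | v \notin nball u r) dist_weight K u v * K ^+ load h v.

(* A lower bound for the probability, given the trajectories [h], that no ball
   is born near [u] and that the far energy stays below [1] until time [M]. *)
Definition survival u h : R :=
  if born_near u h then 0 else
  (1 - beta u) ^+ (M - size h) *
  Num.max 0 (1 - (1 + delta) ^+ (M - size h) * far_energy u h).

Lemma far_energy_ge0 u h : 0 <= far_energy u h.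
Proof.
by apply: sumr_ge0 => v _; rewrite mulr_ge0 ?dist_weight_ge0.
Qed.

Lemma far_energy_rcons u h p :
  far_energy u (rcons h p) = far_energy u h +
    (K - 1) * ((endpoint p \notin nball u r)%:R *
      (dist_weight K u (endpoint p) * K ^+ load h (endpoint p))).
Proof.
set w := endpoint p; rewrite /far_energy.
have [wr|wr] := boolP (w \in nball u r).
  rewrite mul0r mulr0 addr0; apply: eq_bigr => v vr; rewrite load_rcons -/w.
  by case: eqP vr => [<-|_]; rewrite ?wr ?addn0.
rewrite mul1r (bigD1 w) //= [in RHS](bigD1 w) //= load_rcons eqxx addn1 exprS.
rewrite (eq_bigr (fun v => dist_weight K u v * K ^+ load h v)); first ring.
by move=> v /andP[_ vw]; rewrite load_rcons eq_sym (negbTE vw) addn0.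
Qed.

(** Moving towards [u] gains at most a factor [K] per edge in the distance weight, and the drop of
    the load loses at least as much. Reversing the path bounds the weight of the endpoint by that of
    the birthplace. *)
Lemma feasible_far_weight u h p : feasible (load h) p ->
  dist_weight K u (endpoint p) * K ^+ load h (endpoint p) <=
  dist_weight K u p.1 * K ^+ load h p.1.
Proof.
move=> /and3P[pp xp _].
have pp' : path (@adj G) (endpoint p) (rev (belast p.1 p.2)).
  rewrite rev_path (eq_path (e' := @adj G)) // => x y; exact: adj_sym.
have lp : last (endpoint p) (rev (belast p.1 p.2)) = p.1.
  by case: (p) => a [|x s] //=; rewrite rev_cons last_rcons.
apply: le_trans (ler_wpM2r _ (dist_weight_path K1 u pp')) _.
  by rewrite exprn_ge0 // ltW.
rewrite lp size_rev size_belast mulrAC mulrC ler_wpM2l ?dist_weight_ge0 //.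
by rewrite -exprD ler_weXn2l // addnC.
Qed.

Lemma survival_ge0 u h : u \in S -> 0 <= survival u h.
Proof.
move=> /beta1 bu; rewrite /survival; case: ifP => // _.
by rewrite mulr_ge0 ?exprn_ge0 ?le_max ?lexx // subr_ge0; lra.
Qed.

Lemma born_near_rcons u h p :
  born_near u (rcons h p) = (p.1 \in nball u r) || born_near u h.
Proof. by rewrite /born_near has_rcons. Qed.

(** A birth near [u], of probability [beta u], kills the process; otherwise the far energy grows at
    most as if the ball stayed put. Dropping one factor [1 - beta u] and one factor [1 + delta]
    compensates for both in the mean. *)
Lemma survival_step u h : u \in S -> (size h < M)%N -> exists2 l : G -> R,
  forall p, feasible (load h) p -> l p.1 <= survival u (rcons h p) &
  survival u h <= n^-1 * \sum_v l v.
Proof.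
move=> uS hm.
pose k := (M - (size h).+1)%N; have kS : (M - size h)%N = k.+1 by rewrite subnSK.
have bu := beta1 uS; have bu0 := beta0 u.
(* At value zero the bound [0] suffices; otherwise no ball was born near [u] and the maximum is its
   second argument. *)
have [s0|s0] := eqVneq (survival u h) 0.
  exists (fun _ => 0); last by rewrite s0 big1 // mulr0.
  by move=> p _; exact: survival_ge0.
have far : ~~ born_near u h by move: s0; rewrite /survival; case: ifP; rewrite ?eqxx.
set Q := far_energy u h.
pose a := (1 + delta) ^+ k; pose b := (1 - beta u) ^+ k.
have a0 : 0 <= a by exact: growth_ge0.
have b0 : 0 <= b by rewrite exprn_ge0 // subr_ge0; lra.
have e0 : survival u h = (1 - beta u) * b * (1 - (1 + delta) * a * Q).
  move: s0; rewrite /survival (negbTE far) kS !exprS -/a -/b -/Q.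
  by case: leP => // _; rewrite mulr0 eqxx.
pose z v := dist_weight K u v * K ^+ load h v.
have z0 v : 0 <= z v by rewrite mulr_ge0 ?dist_weight_ge0 // exprn_ge0 // ltW.
exists (fun v => if v \in nball u r then 0 else b * (1 - a * (Q + (K - 1) * z v))).
  move=> p fp; case: ifP => vr; first exact: survival_ge0.
  rewrite /survival born_near_rcons vr (negbTE far) /= size_rcons -/k -/a -/b.
  rewrite ler_wpM2l // le_max; apply/orP; right.
  rewrite lerD2l lerN2 ler_wpM2l // far_energy_rcons lerD2l ler_wpM2l ?subr_ge0 //.
  apply: le_trans (feasible_far_weight u fp).
  by case: (_ \notin _); rewrite ?mul1r ?mul0r //; exact: z0.
rewrite (eq_bigr (fun v => (v \notin nball u r)%:R * (b * (1 - a * Q)) -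
     b * a * (K - 1) * ((v \notin nball u r)%:R * z v))); last first.
  by move=> v _; case: (v \in nball u r) => /=; rewrite ?mul0r ?mul1r ?mulr0 ?subr0 //; ring.
rewrite sumrB -mulr_suml -mulr_sumr.
have -> : \sum_v (v \notin nball u r)%:R = n * (1 - beta u).
  have -> : \sum_v (v \notin nball u r)%:R = \sum_v (1 - (v \in nball u r)%:R : R).
    by apply: eq_bigr => v _; case: (v \in nball u r); rewrite ?subrr ?subr0.
  rewrite sumrB sumr_const -natr_sum.
  have -> : (\sum_v (v \in nball u r) = #|nball u r|)%N.
    by rewrite -sum1_card [RHS]big_mkcond; apply: eq_bigr => v _; case: ifP.
  by rewrite /beta mulrBr mulr1 mulrCA mulfV ?mulr1 // gt_eqF.
have -> : \sum_v (v \notin nball u r)%:R * z v = Q.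
  rewrite /Q /far_energy [RHS]big_mkcond; apply: eq_bigr => v _.
  by case: (v \in nball u r); rewrite ?mul1r ?mul0r.
have -> : n^-1 * (n * (1 - beta u) * (b * (1 - a * Q)) - b * a * (K - 1) * Q) =
    b * ((1 - beta u) * (1 - a * Q) - a * Q * ((K - 1) / n)).
  by field; rewrite gt_eqF.
rewrite e0 -mulrA mulrCA ler_wpM2l //.
have -> : (K - 1) / n = delta / 2 by rewrite /delta; field; rewrite gt_eqF.
have aQ : 0 <= a * Q by rewrite mulr_ge0 ?far_energy_ge0.
have := mulr_ge0 aQ delta0; nra.
Qed.

(** The far energy never decreases, so a rise comes only from the two exponents losing one, which is
    worth at most [beta u] and [delta]. *)
Lemma survival_le u h p : u \in S -> (size h < M)%N ->
  survival u (rcons h p) - survival u h <= beta u + delta.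
Proof.
move=> uS hm; have bu := beta1 uS; have bu0 := beta0 u.
have [near|far] := boolP (born_near u (rcons h p)).
  rewrite {1}/survival near sub0r (@le_trans _ _ 0) ?oppr_le0 ?survival_ge0 //.
  by rewrite addr_ge0.
have far' : ~~ born_near u h.
  by apply: contra far; rewrite born_near_rcons => ->; rewrite orbT.
rewrite /survival (negbTE far) (negbTE far') size_rcons -(subnSK hm) !exprS.
set k := (M - (size h).+1)%N; set a := (1 + delta) ^+ k; set b := (1 - beta u) ^+ k.
have a0 : 0 <= a by exact: growth_ge0.
have b0 : 0 <= b by rewrite exprn_ge0 // subr_ge0; lra.
have b1 : b <= 1 by rewrite exprn_ile1 //; lra.
set y := a * far_energy u h; set y' := a * far_energy u (rcons h p).
have y0 : 0 <= y by rewrite mulr_ge0 ?far_energy_ge0.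
have yy' : y <= y'.
  by rewrite /y' far_energy_rcons mulrDr lerDl !mulr_ge0 ?subr_ge0 ?dist_weight_ge0.
rewrite -[(1 + delta) * a * _]mulrA -/y -[(1 - beta u) * b * _]mulrA.
set m := Num.max 0 (1 - (1 + delta) * y); set m' := Num.max 0 (1 - y').
have m0 : 0 <= m by rewrite le_max lexx.
have m1 : 1 - (1 + delta) * y <= m by rewrite le_max lexx orbT.
have X : m' - (1 - beta u) * m <= beta u + delta.
  have dy := mulr_ge0 delta0 y0; have bm : 0 <= (1 - beta u) * m by rewrite mulr_ge0 //; lra.
  have [y1|y1] := leP 1 y.
    rewrite /m' (_ : Num.max _ _ = 0); first by have := delta0; lra.
    by apply/max_idPl; lra.
  have m'1 : m' <= 1 - y by rewrite ge_max; apply/andP; split; lra.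
  have h1 : (1 - beta u) * (1 - (1 + delta) * y) <= (1 - beta u) * m.
    by rewrite ler_wpM2l //; lra.
  have h2 : 0 <= beta u * y by rewrite mulr_ge0.
  have h3 : 0 <= beta u * (delta * y) by rewrite mulr_ge0.
  have h4 : delta * y <= delta by rewrite ler_piMr // ltW.
  by move: h1; rewrite !mulrBl !mulrDl !mul1r mulrBr mulrDr mulr1; lra.
have -> : b * m' - (1 - beta u) * (b * m) = b * (m' - (1 - beta u) * m) by ring.
have bd : 0 <= beta u + delta by rewrite addr_ge0.
by apply: le_trans (ler_wpM2l b0 X) _; rewrite ler_piMl.
Qed.

(** A birth near [u] loses the whole value, which is at most [1]; otherwise the loss comes from the
    growth of the far energy at the endpoint. *)
Lemma survival_ge u h p (L : nat) : u \in S -> (size h < M)%N ->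
  (forall v, load h v <= L)%N ->
  survival u h - survival u (rcons h p) <= (p.1 \in nball u r)%:R +
    (1 + delta) ^+ M * (K - 1) * K ^+ L *
      ((endpoint p \notin nball u r)%:R * dist_weight K u (endpoint p)).
Proof.
move=> uS hm hL; have bu := beta1 uS; have bu0 := beta0 u.
set w := endpoint p; set z := (w \notin _)%:R * _.
have z0 : 0 <= z by rewrite mulr_ge0 ?dist_weight_ge0.
have rhs0 : 0 <= (1 + delta) ^+ M * (K - 1) * K ^+ L * z.
  by rewrite mulr_ge0 // mulr_ge0 // mulr_ge0 ?subr_ge0.
have s'0 := survival_ge0 (rcons h p) uS.
have [near|far'] := boolP (born_near u h).
  rewrite {1}/survival near sub0r (@le_trans _ _ 0) ?oppr_le0 //.
  by rewrite addr_ge0.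
set k := (M - (size h).+1)%N; set a := (1 + delta) ^+ k; set b := (1 - beta u) ^+ k.
have a0 : 0 <= a by exact: growth_ge0.
have b0 : 0 <= b by rewrite exprn_ge0 // subr_ge0; lra.
have b1 : b <= 1 by rewrite exprn_ile1 //; lra.
have s_le : survival u h <= b * Num.max 0 (1 - a * far_energy u h).
  rewrite /survival (negbTE far') -(subnSK hm) !exprS -/k -/a -/b -mulrA.
  have mono : Num.max 0 (1 - (1 + delta) * a * far_energy u h) <=
      Num.max 0 (1 - a * far_energy u h).
    rewrite ge_max !le_max lexx /=; apply/orP; right.
    rewrite lerD2l lerN2 -mulrA ler_peMl ?lerDl // mulr_ge0 ?far_energy_ge0 //.
  apply: (@le_trans _ _ (1 * (b * Num.max 0 (1 - (1 + delta) * a * far_energy u h)))).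
    by rewrite ler_wpM2r ?mulr_ge0 ?le_max ?lexx //; lra.
  by rewrite mul1r ler_wpM2l.
have [near|far] := boolP (p.1 \in nball u r).
  rewrite {2}/survival born_near_rcons near /= subr0.
  apply: (@le_trans _ _ 1); last by rewrite lerDl.
  apply: le_trans s_le _; rewrite mulr_ile1 ?le_max ?lexx // ge_max ler01 /=.
  by rewrite gerBl mulr_ge0 ?far_energy_ge0.
rewrite add0r [survival u (rcons h p)]/survival born_near_rcons.
rewrite (negbTE far) (negbTE far') /=.
rewrite size_rcons -/k -/a -/b.
apply: le_trans (lerB s_le (lexx _)) _.
have inc : a * far_energy u (rcons h p) - a * far_energy u h <=
    (1 + delta) ^+ M * (K - 1) * K ^+ L * z.
  rewrite -mulrBr far_energy_rcons addrAC subrr add0r -/w.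
  have -> : a * ((K - 1) * ((w \notin nball u r)%:R *
      (dist_weight K u w * K ^+ load h w)))
     = a * (K - 1) * K ^+ load h w * z by rewrite /z; ring.
  rewrite ler_wpM2r // ler_pM ?mulr_ge0 ?subr_ge0 ?ler_weXn2l //.
  by rewrite ler_wpM2r ?subr_ge0 // ler_weXn2l ?leq_subr // lerDl.
set y' := a * far_energy u (rcons h p) in inc *; set y := a * far_energy u h in inc *.
rewrite -mulrBr.
have [le|gt] := leP (Num.max 0 (1 - y)) (Num.max 0 (1 - y')).
  apply: le_trans rhs0; rewrite mulr_ge0_le0 // subr_le0 //.
apply: (@le_trans _ _ (Num.max 0 (1 - y) - Num.max 0 (1 - y'))).
  by rewrite ler_piMl // subr_ge0 ltW.
rewrite lerBlDr ge_max; apply/andP; split.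
  by rewrite addr_ge0 // le_max lexx.
have : 1 - y' <= Num.max 0 (1 - y') by rewrite le_max lexx orbT.
by move: inc; lra.
Qed.

Definition survival_inv h : Prop :=
  forall u, ~~ born_near u h -> far_energy u h < 1 -> load h u = 0%N.

(** If a ball born far away were the first to end at [u], its birthplace would have a load no
    smaller than the length of its trajectory. That summand alone would make the far energy at least
    [1]. *)
Lemma survival_inv_rcons h p :
  survival_inv h -> feasible (load h) p -> survival_inv (rcons h p).
Proof.
move=> inv fp u; rewrite born_near_rcons negb_or => /andP[pu far] Q1.
have Q0 : far_energy u h < 1.
  apply: le_lt_trans Q1; rewrite far_energy_rcons lerDl.
  by rewrite !mulr_ge0 ?subr_ge0 ?dist_weight_ge0.
have hu := inv u far Q0; rewrite load_rcons hu add0n.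
case: eqP => // eu; case/and3P: fp => pp; rewrite eu hu add0n => xp _.
have pu' : p.1 \in nball u (size p.2).
  by rewrite nball_sym; apply/nballP; exists p.2.
suff : 1 <= far_energy u h by rewrite leNgt Q0.
rewrite /far_energy (bigD1 p.1) //=.
apply: (@le_trans _ _ (K ^- size p.2 * K ^+ load h p.1)).
  by rewrite mulrC ler_pdivlMr ?exprn_gt0 // mul1r ler_weXn2l.
rewrite -[leLHS]addr0 lerD ?ler_wpM2r ?dist_weight_ge //.
by apply: sumr_ge0 => v _; rewrite mulr_ge0 ?dist_weight_ge0.
Qed.

Variables (L : nat) (B kappa sigma c theta : R).
Hypothesis hB : forall u, u \in S -> #|nball u r|%:R <= B.
Hypothesis hkappa : forall v, \sum_(u in S) (v \in nball u r)%:R <= kappa.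
Hypothesis hsigma : forall w,
  \sum_(u in S) (w \notin nball u r)%:R * dist_weight K u w <= sigma.
Hypothesis hc :
  kappa + (1 + delta) ^+ M * (K - 1) * K ^+ L * sigma + (B + 2 * (K - 1)) <= c.
Hypothesis theta0 : 0 <= theta.
Hypothesis thetac : theta * c <= 2^-1.
Hypothesis B0 : 0 <= B.

Let total h := \sum_(u in S) survival u h.

Let kappa0 : 0 <= kappa.
Proof.
have [v _] : exists v : G, true by case/card_gt0P: G0 => v _; exists v.
by apply: le_trans (hkappa v); apply: sumr_ge0.
Qed.

Let sigma0 : 0 <= sigma.
Proof.
have [v _] : exists v : G, true by case/card_gt0P: G0 => v _; exists v.
apply: le_trans (hsigma v); apply: sumr_ge0 => u _.
by rewrite mulr_ge0 ?dist_weight_ge0.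
Qed.

Let growth0 : 0 <= (1 + delta) ^+ M * (K - 1) * K ^+ L.
Proof. by rewrite mulr_ge0 // mulr_ge0 ?subr_ge0. Qed.

(** In a drop, births near members of [S] account for [kappa] and far energies for the term in
    [sigma]. In a rise, [B / n + delta] summed over all [n] vertices gives [B + 2 * (K - 1)]. *)
Lemma total_diff h p : (size h < M)%N -> (forall v, load h v <= L)%N ->
  `|total (rcons h p) - total h| <= c.
Proof.
move=> hm hL; have K10 : 0 <= K - 1 by rewrite subr_ge0.
have gs := mulr_ge0 growth0 sigma0.
rewrite ler_norml; apply/andP; split.
  rewrite lerNl opprB /total -sumrB.
  apply: le_trans (ler_sum _ (fun u uS => survival_ge p uS hm hL)) _.
  rewrite big_split /= -mulr_sumr; apply: le_trans hc.
  apply: (@le_trans _ _ (kappa + (1 + delta) ^+ M * (K - 1) * K ^+ L * sigma)).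
    by rewrite lerD // ler_wpM2l.
  by rewrite lerDl addr_ge0 // mulr_ge0.
rewrite /total -sumrB.
apply: le_trans (ler_sum _ (fun u uS => survival_le p uS hm)) _.
apply: le_trans hc; apply: (@le_trans _ _ (B + 2 * (K - 1))); last first.
  by rewrite lerDr addr_ge0.
apply: (@le_trans _ _ (\sum_(u in S) (B / n + delta))).
  apply: ler_sum => u uS; rewrite lerD2r /beta ler_wpM2r ?invr_ge0 ?(ltW n0) //.
  exact: hB.
apply: (@le_trans _ _ (\sum_(u : G) (B / n + delta))).
  rewrite [leRHS](bigID (mem S)) /= lerDl sumr_ge0 // => u _.
  by rewrite addr_ge0 // divr_ge0 // ltW.
rewrite sumr_const -[leLHS]mulr_natl -/n /delta le_eqVlt; apply/predU1P; left.
by field; rewrite gt_eqF.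
Qed.

(** Exponential moments of a submartingale with increments at most [c]: each step costs at most the
    second-order term [2 * (theta * c) ^ 2]. *)
Lemma covered_prob_le (d : measure_display) (T : measurableType d)
    (P : probability T R) (W : nat -> T -> trajectory G) :
  local_search_allocation P W ->
  (P [set w | (forall u, u \in S -> (0 < load (history W M w) u)%N) /\
              (forall u, load (history W M w) u <= L)%N] <=
   (expR (2 * (theta * c) ^+ 2 * M%:R - theta * \sum_(u in S) survival u [::]))%:E)%E.
Proof.
move=> WP; pose e := 2 * (theta * c) ^+ 2.
have e0 : 0 <= e by rewrite mulr_ge0 // exprn_even_ge0.
(* Set to zero once a load exceeds [L]: loads never decrease, the event asks for small loads, and so
   does the increment bound. *)
pose Phi h := if [forall u, (load h u <= L)%N] then
  expR (e * (M - size h)%:R - theta * total h) else 0.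
apply: le_trans (supermartingale_bound WP (Inv := survival_inv)
   (E := fun h => (forall u, u \in S -> (0 < load h u)%N) /\ (forall u, load h u <= L)%N)
   (Phi := Phi) G0 _ _ _ _ _) _.
- by [].
- exact: survival_inv_rcons.
- by move=> h; rewrite /Phi; case: ifP => // _; exact: expR_ge0.
- move=> h _ hm.
  have [/forallP hL|hL] := boolP [forall u, (load h u <= L)%N]; last first.
    exists (fun=> 0); last by rewrite big1 // mulr0 /Phi (negbTE hL).
    move=> p _; rewrite /Phi ifF //; apply/negbTE; apply: contra hL => /forallP hL.
    apply/forallP => u; apply: leq_trans (hL u); rewrite load_rcons leq_addr //.
  have /choice[l lP] u : exists l : G -> R, u \in S -> 
     (forall p, feasible (load h) p -> l p.1 <= survival u (rcons h p)) /\
      survival u h <= n^-1 * \sum_v l v.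
    have [uS|_] := boolP (u \in S); last by exists (fun=> 0).
    by have [l h1 h2] := survival_step uS hm; exists l.
  pose k := (M - (size h).+1)%N; have kS : (M - size h)%N = k.+1 by rewrite subnSK.
  pose l' v := \sum_(u in S) l u v.
  exists (fun v => expR (e * k%:R - theta * total h) *
                   (1 - theta * (l' v - total h) + e)).
    move=> p fp.
    have lt : l' p.1 <= total (rcons h p).
      by apply: ler_sum => u uS; have [h1 _] := lP u uS; exact: h1.
    have rhs_le : expR (e * k%:R - theta * total (rcons h p)) <=
       expR (e * k%:R - theta * total h) * (1 - theta * (l' p.1 - total h) + e).
      set y := theta * (total (rcons h p) - total h).
      have -> : e * k%:R - theta * total (rcons h p) =
         e * k%:R - theta * total h + - y by rewrite /y; ring.
      rewrite expRD ler_wpM2l ?expR_ge0 //.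
      have yc : `|y| <= theta * c.
        by rewrite normrM ger0_norm // ler_wpM2l // total_diff.
      apply: le_trans (expRN_le (le_trans yc thetac)) _; rewrite lerD //.
        by rewrite lerD2l lerN2 ler_wpM2l // lerD2r.
      rewrite /e ler_wpM2l // -[y ^+ 2]real_normK ?num_real //.
      by rewrite lerXn2r ?nnegrE // (le_trans _ yc).
    rewrite /Phi size_rcons; case: ifP => // _.
    by apply: le_trans rhs_le; exact: expR_ge0.
  rewrite -mulr_sumr mulrCA /Phi ifT; last exact/forallP.
  rewrite kS -[k.+1]addn1 natrD mulrDr mulr1.
  have -> : e * k%:R + e - theta * total h = e * k%:R - theta * total h + e by ring.
  rewrite [leRHS]expRD ler_wpM2l ?expR_ge0 //; apply: le_trans (expR_ge1Dx e).
  rewrite big_split /= sumrB -mulr_sumr sumrB !sumr_const.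
  rewrite -[1 *+ _]/n -[e *+ _]mulr_natl -[total h *+ _]mulr_natl -/n.
  have -> : n^-1 * (n - theta * (\sum_v l' v - n * total h) + n * e) =
     1 + e - theta * (n^-1 * \sum_v l' v - total h) by field; rewrite gt_eqF.
  rewrite gerBl mulr_ge0 // subr_ge0 /l' exchange_big /= mulr_sumr.
  by apply: ler_sum => u uS; have [_] := lP u uS.
(* A covered [u] has had a birth nearby or has far energy at least [1], by [survival_inv]; either
   way its summand vanishes at time [M]. *)
- move=> h inv hm [cov hL]; rewrite /Phi ifT; last exact/forallP.
  rewrite hm subnn mulr0 sub0r /total big1 ?mulr0 ?oppr0 ?expR0 // => u uS.
  rewrite /survival; case: ifP => // /negbT far; rewrite hm subnn !expr0 !mul1r.
  apply/max_idPl; rewrite subr_le0 leNgt; apply/negP => Q1.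
  by have := cov u uS; rewrite (inv u far Q1).
rewrite lee_fin /Phi subn0; case: ifP => // _; exact: expR_ge0.
Qed.

End CoverLowerBound.

(** * Cover time *)

Section CoverTime.
Variables (R : realType) (G : graph) (d : measure_display)
  (T : measurableType d) (P : probability T R) (W : nat -> T -> trajectory G).
Hypothesis WP : local_search_allocation P W.

Lemma load_history_le m m' w v : (m <= m')%N ->
  (load (history W m w) v <= load (history W m' w) v)%N.
Proof.
move=> mm'; rewrite /load /history /mkseq -(subnKC mm') iotaD map_cat count_cat.
exact: leq_addr.
Qed.

Lemma Tcov_ltE (x : R) w : (Tcov R W w < x%:E)%E <->
  exists m, m%:R < x /\ forall v, (1 <= load (history W m w) v)%N.
Proof.
split=> [/min_or_infty_lt[m h mx]|[m [mx h]]]; first by exists m.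
by apply: le_lt_trans (min_or_infty_le _ h) _; rewrite lte_fin.
Qed.

Lemma measurable_Tcov_lt (x : R) : measurable [set w | (Tcov R W w < x%:E)%E].
Proof.
rewrite (_ : mkset _ = \bigcup_m [set w |
  m%:R < x /\ forall v, (1 <= load (history W m w) v)%N]).
  apply: countable_bigcupT_measurable => [|m]; first exact: countableP.
  exact: (measurable_history WP m
    (fun h => m%:R < x /\ forall v, (1 <= load h v)%N)).
by apply/seteqP; split => w /=; rewrite Tcov_ltE; [move=> [m h]|move=> [m _ h]]; exists m.
Qed.

Lemma measurable_le_Tcov (x : R) : measurable [set w | (x%:E <= Tcov R W w)%E].
Proof.
rewrite (_ : mkset _ = ~` [set w | (Tcov R W w < x%:E)%E]).
  by apply: measurableC; exact: measurable_Tcov_lt.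
by apply/seteqP; split => w /=; rewrite leNgt => /negP.
Qed.

End CoverTime.

Lemma nat_min_in (A : set nat) : A !=set0 -> A (nat_min A).
Proof.
move=> [a Aa]; suff : (A `&` lbound A) (nat_min A) by case.
apply: xgetPex; have exA : exists k, `[< A k >] by exists a; apply/asboolP.
exists (ex_minn exA); case: ex_minnP => k /asboolP Ak mink; split => // j Aj.
by rewrite leEnat; apply: mink; apply/asboolP.
Qed.

Section R2Facts.
Variables (R : realType) (G : graph).
Hypothesis G0 : (0 < #|G|)%N.

Lemma R2_spec : (0 < R2 R G)%N /\
  forall u : G, ln (#|G|%:R : R) <= (R2 R G)%:R * #|nball u (R2 R G)|%:R.
Proof.
have [h1 h2] : [set r | (0 < r)%N /\ forall u : G,
    ln (#|G|%:R : R) <= r%:R * #|gball R u r|%:R] (R2 R G).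
  (* The radius [#|G|] qualifies, as balls are nonempty and [ln n <= n]. *)
  apply: nat_min_in; exists #|G|; split => // u.
  have n1 : 1 <= #|G|%:R :> R by rewrite ler1n.
  apply: (@le_trans _ _ #|G|%:R).
    by have := @ln_sublinear R #|G|%:R; rewrite ltr0n => /(_ G0)/ltW.
  rewrite ler_peMr ?ler0n // ler1n gballE card_gt0.
  by apply/set0Pn; exists u; exact: nball_self.
by split => // u; have := h2 u; rewrite gballE.
Qed.

End R2Facts.

Lemma cover_time_upper (R : realType) (D : nat) (alpha : R) : 0 <= alpha ->
  exists C : R, forall G : graph, max_degree G = D -> 2 <= ln (#|G|%:R : R) ->
  forall (d : measure_display) (T : measurableType d) (P : probability T R)
         (W : nat -> T -> trajectory G),
    local_search_allocation P W ->
    (P [set w | ((C * (R2 R G)%:R * #|G|%:R)%:E <= Tcov R W w)%E]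
       <= (#|G|%:R `^ (- alpha))%:E)%E.
Proof.
(* [2 * D.+1] makes the weights summable and [expR (alpha + 2)] makes [ln K] at least [alpha + 2];
   for [ln n >= 2], [n * expR 2 / n ^ ln K] is then at most [n ^ (- alpha)]. *)
move=> alpha0; pose K : R := 2 * D.+1%:R * expR (alpha + 2).
have D0 : 0 < 2 * D.+1%:R :> R by rewrite mulr_gt0.
have D1 : 1 <= 2 * D.+1%:R :> R by rewrite mulr_ege1 // ler1n.
have K0 : 0 < K by rewrite mulr_gt0 ?expR_gt0.
have alphaK : alpha + 2 <= ln K.
  rewrite -[leLHS]expRK ler_ln ?posrE ?expR_gt0 // /K ler_peMl //; exact: expR_ge0.
pose C0 := (Num.truncn (6 * ln K)).+1.
have KC : K ^+ 3 <= expR (C0%:R / 2).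
  rewrite -[K in leLHS]lnK ?posrE // -expRM_natl ler_expR ler_pdivlMr //.
  by rewrite mulrAC -natrM ltW // truncnS_gt.
(* One more than [C0], so that time [C0 * r * n] lies strictly before the bound on [Tcov]. *)
exists C0.+1%:R => G GD lnG d T P W WP.
have n0 : 0 < #|G|%:R :> R.
  by rewrite ltNge; apply/negP => /ln0 h; move: lnG; rewrite h; lra.
have G0 : (0 < #|G|)%N by rewrite -(ltr0n R).
have [r0 hr] := R2_spec R G0; set r := R2 R G in r0 hr *.
have KD : 2 * (max_degree G).+1%:R <= K.
  rewrite GD /K ler_peMr ?(ltW D0) //; apply: le_trans (expR_ge1Dx _); lra.
have main := uncovered_prob_le G0 KD KC hr WP.
apply: (@le_trans _ _ (P [set w | exists u, load (history W (C0 * r * #|G|) w) u = 0%N])).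
  apply: le_measure; rewrite ?inE; first exact: (measurable_le_Tcov WP).
    exact: (measurable_history WP _ (fun h => exists u, load h u = 0%N)).
  move=> w /=; rewrite leNgt => /negP nT; apply: contrapT => cov; apply: nT.
  apply/Tcov_ltE; exists (C0 * r * #|G|)%N; split.
    by rewrite -!natrM ltr_nat !ltn_pmul2r.
  by move=> v; rewrite lt0n; apply/eqP => v0; apply: cov; exists v.
apply: le_trans main _; rewrite lee_fin.
rewrite ler_pdivrMr ?powR_gt0 // -powRD; last by rewrite (gt_eqF n0) implybT.
have -> : #|G|%:R * expR 2 = expR (ln #|G|%:R + 2) :> R by rewrite expRD lnK.
rewrite /powR (gt_eqF n0) ler_expR.
apply: (@le_trans _ _ (2 * ln #|G|%:R)); first lra.
by rewrite ler_wpM2r; lra.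
Qed.

(** The quadratic term of [(1 + t / 2) ^ 2 <= expR t] absorbs the affine function. *)
Lemma affine_le_expR (R : realType) (a b t : R) : 0 <= a -> 0 <= b -> 1 <= t ->
  4 * (a + b) <= t -> a + b * t <= expR t.
Proof.
move=> a0 b0 t1 abt.
have -> : t = 2%:R * (t / 2) by field.
rewrite [leRHS]expRM_natl; apply: (@le_trans _ _ ((1 + t / 2) ^+ 2)).
  have h : 0 <= (t - 4 * (a + b)) * t by rewrite mulr_ge0; lra.
  have h' : 0 <= (t - 1) * a by rewrite mulr_ge0; lra.
  by rewrite expr2; lra.
by rewrite lerXn2r ?nnegrE ?expR_ge0 ?expR_ge1Dx //; lra.
Qed.

Lemma survival_nil_ge (R : realType) (G : graph) (gamma : R) (r M : nat) (u : G) :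
  (0 < #|G|)%N -> (0 < max_degree G)%N -> 0 <= gamma -> gamma <= 2^-1 -> (0 < r)%N ->
  M%:R <= gamma * r%:R * #|G|%:R / (8 * (max_degree G)%:R) ->
  r%:R * #|nball u r|%:R <= ln (#|G|%:R : R) ->
  2 * #|nball u r|%:R <= (#|G|%:R : R) ->
  #|G|%:R `^ (- (gamma / 4)) / 2 <=
    survival (4 * (max_degree G)%:R + 1) r M u [::].
Proof.
move=> G0; set D := max_degree G; set n : R := #|G|%:R; set b : R := #|nball u r|%:R.
move=> D0 gamma0 gamma1 r0 hM hb bn.
have n0 : 0 < n by rewrite ltr0n.
have d1 : 1 <= D%:R :> R by rewrite ler1n.
have r1 : 1 <= r%:R :> R by rewrite ler1n.
rewrite /survival /= subn0 -/n -/b; set K : R := 4 * D%:R + 1.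
have K1 : 1 <= K by rewrite /K; lra.
set delta := 2 * (K - 1) / n; set Q := far_energy _ _ _ _.
have delta0 : 0 <= delta by rewrite divr_ge0 ?(ltW n0) // /K; lra.
(* All loads are zero, so the energy is a sum of weights; [q = 2 / 5] suits [K = 4 * D + 1] because
   [D >= 1]. *)
have Q_le : Q <= (2 / 5) ^+ r * (2 / 3).
  have q0 : 0 <= 2 / 5 :> R by lra.
  have q1 : 2 / 5 < 1 :> R by lra.
  have qK : (max_degree G).+1%:R <= 2 / 5 * K by rewrite -/D /K -natr1; lra.
  rewrite /Q /far_energy; apply: le_trans (_ : (2 / 5) ^+ r.+1 / (1 - 2 / 5) <= _).
    apply: le_trans (sum_dist_weight K1 u r q0 q1 qK).
    by apply: ler_sum => v _; rewrite expr0 mulr1.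
  by rewrite exprSr le_eqVlt; apply/predU1P; left; field.
have Q0 : 0 <= Q by exact: far_energy_ge0.
have p87 : 0 <= 8 / 7 :> R by lra.
have pdelta : 0 <= 1 + delta by lra.
(* [delta * M <= gamma * r <= r / 2], and [expR (1 / 8) <= 8 / 7]. *)
have growth : (1 + delta) ^+ M <= (8 / 7) ^+ 4 ^+ r.
  apply: (@le_trans _ _ (expR delta ^+ M)).
    by rewrite lerXn2r ?nnegrE ?expR_ge0 ?expR_ge1Dx.
  rewrite -expRM_natl; apply: (@le_trans _ _ (expR (r%:R * (4%:R * (8^-1))))).
    rewrite ler_expR; apply: (@le_trans _ _ (gamma * r%:R)).
      move: hM; rewrite ler_pdivlMr; last lra.
      move=> hM; rewrite /delta /K mulrA ler_pdivrMr //.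
      by move: hM; rewrite -/n; lra.
    by rewrite mulrC ler_wpM2l //; lra.
  rewrite [leLHS]expRM_natl lerXn2r ?nnegrE ?expR_ge0 ?exprn_ge0 //.
  rewrite expRM_natl lerXn2r ?nnegrE ?expR_ge0 //.
  have p87' : 0 < 8 / 7 :> R by lra.
  rewrite -[8^-1]opprK expRN invf_ple ?posrE ?expR_gt0 //.
  by apply: le_trans (expR_ge1Dx _); rewrite -div1r ler_pdivrMr //; lra.
have gQ : (1 + delta) ^+ M * Q <= 2^-1.
  apply: (@le_trans _ _ ((8 / 7) ^+ 4 ^+ r * ((2 / 5) ^+ r * (2 / 3)))).
    by rewrite ler_pM // exprn_ge0.
  rewrite mulrA -exprMn.
  apply: (@le_trans _ _ (((8 / 7) ^+ 4 * (2 / 5)) ^+ 1 * (2 / 3))); last by lra.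
  by rewrite ler_wpM2r ?ler_wiXn2l //; lra.
have beta0 : 0 <= b / n by rewrite divr_ge0 // ltW.
have beta1 : b / n <= 2^-1 by rewrite ler_pdivrMr //; lra.
have pbeta : 0 <= 1 - b / n by lra.
(* [1 - y >= expR (- 2 * y)] for [0 <= y <= 1 / 2], and [2 * (b / n) * M] is at most
   [gamma / 4 * ln n] because [r * b <= ln n]. *)
have pow : n `^ (- (gamma / 4)) <= (1 - b / n) ^+ M.
  rewrite /powR (gt_eqF n0); apply: (@le_trans _ _ (expR (- (2 * (b / n))) ^+ M)).
    rewrite -expRM_natl ler_expR mulNr mulrN lerN2.
    move: hM; rewrite ler_pdivlMr; last lra.
    move=> hM; rewrite mulrCA mulrA mulrA ler_pdivrMr //.
    have h1 : 0 <= gamma * (ln n - r%:R * b) * n.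
      by rewrite mulr_ge0 ?(ltW n0) // mulr_ge0 // subr_ge0.
    have h2 : 0 <= b * (gamma * r%:R * n - M%:R * (8 * D%:R)).
      by rewrite mulr_ge0 // subr_ge0.
    have h3 : 0 <= (D%:R - 1) * (b * M%:R) by rewrite !mulr_ge0 // subr_ge0.
    by lra.
  rewrite lerXn2r ?nnegrE ?expR_ge0 //.
  have pbeta' : 0 < 1 - b / n by lra.
  rewrite expRN invf_ple ?posrE ?expR_gt0 //.
  apply: le_trans (expR_ge1Dx _); rewrite -div1r ler_pdivrMr //.
  have : 0 <= (b / n) * (2^-1 - b / n) by rewrite mulr_ge0 // subr_ge0.
  by lra.
have half : 0 <= 2^-1 :> R by lra.
rewrite ler_pM ?powR_ge0 //.
by rewrite le_max; apply/orP; right; lra.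
Qed.

(** * Overlaps of balls and sums of far weights *)

Section Overlap.
Variables (R : realType) (G : graph) (S : {set G}) (r : nat).

Lemma sum_mem_nball v :
  \sum_(u in S) (v \in nball u r)%:R = #|(S :&: nball v r)%SET|%:R :> R.
Proof.
rewrite -sum1_card natr_sum [LHS]big_mkcond [RHS]big_mkcond /=.
apply: eq_bigr => u _; rewrite inE -(nball_sym v u).
by case: (u \in S); case: (u \in nball v r).
Qed.

(** If the balls around members of [S] are whole components, the members near [v] all lie in a
    single such ball. *)
Lemma overlap_component (B : R) : 0 <= B ->
  (forall u, u \in S -> #|nball u r|%:R <= B) ->
  (forall u, u \in S -> forall k w, w \in nball u k -> w \in nball u r) ->
  forall v, \sum_(u in S) (v \in nball u r)%:R <= B.
Proof.
move=> B0 hB comp v; rewrite sum_mem_nball.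
have [->|[u0]] := set_0Vmem (S :&: nball v r)%SET; first by rewrite finset.cards0.
rewrite inE => /andP[u0S u0v]; apply: le_trans (hB u0 u0S).
rewrite ler_nat; apply: subset_leq_card; apply/fintype.subsetP => u.
rewrite inE => /andP[_ /nballP[p [pp pl _]]].
have vu0 : v \in nball u0 r by rewrite nball_sym.
by apply: (comp u0 u0S (r + size p)%N); rewrite -pl; exact: nball_path.
Qed.

Lemma overlap_general v :
  \sum_(u in S) (v \in nball u r)%:R <= (max_degree G).+1%:R ^+ r :> R.
Proof.
rewrite sum_mem_nball -natrX ler_nat; apply: leq_trans (card_nball v r).
by apply: subset_leq_card; exact: finset.subsetIr.
Qed.

Lemma sum_far_weight_le (K : R) : 2 * (max_degree G).+1%:R <= K -> forall w,
  \sum_(u in S) (w \notin nball u r)%:R * dist_weight K u w <= 2.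
Proof.
move=> KD w.
have K1 : 1 <= K by apply: le_trans KD; rewrite mulr_ege1 // ler1n.
apply: (@le_trans _ _ (\sum_u dist_weight K w u)); last exact: sum_dist_weight_le2.
rewrite [leRHS](bigID (mem S)) /= -[leLHS]addr0 lerD //.
  apply: ler_sum => u _; rewrite (dist_weight_sym K w u).
  by case: (w \notin _); rewrite ?mul1r ?mul0r ?dist_weight_ge0.
by apply: sumr_ge0 => u _; exact: dist_weight_ge0.
Qed.

Lemma sum_far_weight_component (K : R) :
  (forall u, u \in S -> forall k w, w \in nball u k -> w \in nball u r) ->
  forall w, \sum_(u in S) (w \notin nball u r)%:R * dist_weight K u w <= 0.
Proof.
move=> comp w; rewrite big1 // => u uS.
have [wr|wr] := boolP (w \in nball u r); first by rewrite mul0r.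
rewrite mul1r /dist_weight; elim/big_ind: _ => // [x y -> ->|k wk].
  by rewrite maxxx.
by rewrite (comp u uS k w wk) in wr.
Qed.

End Overlap.

Lemma affine_le_expR_near (R : realType) (a b s : R) :
  0 <= a -> 0 <= b -> 0 < s -> \forall l \near +oo, a + b * l <= expR (s * l).
Proof.
move=> a0 b0 s0; exists ((1 + 4 * (a + b / s)) / s); split; first exact: num_real.
move=> l; rewrite ltr_pdivrMr // mulrC => /ltW h.
have bs : 0 <= b / s by rewrite divr_ge0 // ltW.
have -> : b * l = b / s * (s * l) by field; rewrite gt_eqF.
by apply: affine_le_expR => //; lra.
Qed.

(** The exponential inequalities are what a large [n] provides; [kappa], [sigma] and [L] stay free
    because they are chosen differently in two cases. *)
Lemma covered_prob_decay (R : realType) (G : graph) (gamma A : R) (S : {set G})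
    (r M L : nat) (kappa sigma : R) :
  let n : R := #|G|%:R in let D : R := (max_degree G)%:R in
  let K : R := 4 * D + 1 in
  (0 < #|G|)%N -> (0 < max_degree G)%N -> 0 < gamma -> gamma <= 2^-1 -> (0 < r)%N ->
  M%:R <= gamma * r%:R * n / (8 * D) ->
  n `^ (2^-1 + gamma) <= #|S|%:R ->
  (forall u, u \in S -> r%:R * #|nball u r|%:R < ln n) ->
  (forall v, \sum_(u in S) (v \in nball u r)%:R <= kappa) ->
  (forall w, \sum_(u in S) (w \notin nball u r)%:R * dist_weight K u w <= sigma) ->
  kappa + expR r%:R * (4 * D) * K ^+ L * sigma + (ln n + 8 * D) <=
    expR (gamma / 4 * ln n) ->
  2 * ln n <= expR (ln n) ->
  2 <= expR ((2^-1 + gamma / 4) * ln n) ->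
  2 * ln n <= expR (gamma / 2 * ln n) ->
  2 + 2 * (A + 1) * ln n <= expR (gamma / 4 * ln n) ->
  forall (d : measure_display) (T : measurableType d) (P : probability T R)
         (W : nat -> T -> trajectory G),
    local_search_allocation P W ->
    (P [set w | (forall u, u \in S -> (0 < load (history W M w) u)%N) /\
                (forall u, load (history W M w) u <= L)%N] <=
     (expR (- ((A + 1) * ln n)))%:E)%E.
Proof.
move=> n D K G0 D0 gamma0 gamma1 r0 hM cardS hS hkappa hsigma hc e1 e2 e3 e4 d T P W WP.
have n0 : 0 < n by rewrite ltr0n.
have nE : n = expR (ln n) by rewrite lnK ?posrE.
set l := ln n in nE hS hc e1 e2 e3 e4 *.
have D1 : 1 <= D by rewrite ler1n.
have r1 : 1 <= r%:R :> R by rewrite ler1n.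
have K1 : 1 <= K by rewrite /K; lra.
have D8 : 0 < 8 * D by lra.
have [u0 u0S] : exists u0, u0 \in S.
  apply/card_gt0P; rewrite -(ltr0n R); apply: lt_le_trans cardS.
  exact: powR_gt0.
have ball1 (u : G) : 1 <= #|nball u r|%:R :> R.
  by rewrite ler1n card_gt0; apply/set0Pn; exists u; exact: nball_self.
have ball_l u : u \in S -> #|nball u r|%:R <= l.
  move=> /hS /ltW; apply: le_trans; rewrite ler_peMl //.
have r_l : r%:R <= l.
  by apply: le_trans (ltW (hS u0 u0S)); rewrite ler_peMr.
have l0 : 0 <= l by lra.
have hb u : u \in S -> 2 * #|nball u r|%:R <= n.
  by move=> /ball_l h; rewrite nE; lra.
(* With [theta = n ^ (- (1/2 + gamma/2))] and [c = n ^ (gamma/4)], the quadratic cost is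
   [2 * M / n ^ (1 + gamma/2)], at most [1], while [theta] times the initial total is at least
   [n ^ (gamma/4) / 2]. *)
pose theta := expR (- (2^-1 + gamma / 2) * l).
pose c := expR (gamma / 4 * l).
have tc : theta * c = expR (- ((2^-1 + gamma / 4) * l)).
  by rewrite /theta /c -expRD; congr expR; lra.
have thetac : theta * c <= 2^-1.
  by rewrite tc expRN lef_pV2 ?posrE ?expR_gt0.
have Mn : M%:R <= gamma * r%:R * n.
  apply: le_trans hM _; rewrite ler_pdivrMr // ler_peMr ?mulr_ge0 ?(ltW n0) ?(ltW gamma0) //.
  lra.
have K4 : K - 1 = 4 * D by rewrite /K; lra.
have growth : (1 + 2 * (K - 1) / n) ^+ M <= expR r%:R.
  apply: (@le_trans _ _ (expR (2 * (K - 1) / n) ^+ M)).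
    rewrite lerXn2r ?nnegrE ?expR_ge0 ?expR_ge1Dx // addr_ge0 // divr_ge0 ?(ltW n0) //.
    by rewrite K4; lra.
  rewrite -expRM_natl ler_expR mulrA ler_pdivrMr // K4.
  move: hM; rewrite ler_pdivlMr // => hM; have : 0 <= (1 - gamma) * (r%:R * n).
    by rewrite mulr_ge0 ?mulr_ge0 ?(ltW n0) //; lra.
  by lra.
have hc' : kappa + (1 + 2 * (K - 1) / n) ^+ M * (K - 1) * K ^+ L * sigma +
    (l + 2 * (K - 1)) <= c.
  apply: le_trans hc; rewrite lerD //; last by rewrite K4; lra.
  rewrite lerD2l K4; have sigma0 : 0 <= sigma.
    apply: le_trans (hsigma u0); apply: sumr_ge0 => u _.
    by rewrite mulr_ge0 ?dist_weight_ge0.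
  rewrite ler_wpM2r // ler_wpM2r ?exprn_ge0 //; first lra.
  by rewrite ler_wpM2r // -K4; lra.
apply: le_trans (covered_prob_le (L := L) (M := M) G0 K1 hb ball_l hkappa hsigma hc'
   (expR_ge0 _) thetac l0 WP) _.
rewrite lee_fin ler_expR.
have t1 : 2 * (theta * c) ^+ 2 * M%:R <= 1.
  have Ml : M%:R / n <= l.
    rewrite ler_pdivrMr //; apply: le_trans Mn _; rewrite ler_wpM2r ?(ltW n0) //.
    by apply: le_trans r_l; rewrite ler_piMl //; lra.
  have -> : (theta * c) ^+ 2 = n^-1 / expR (gamma / 2 * l).
    have -> : n^-1 = expR (- l) by rewrite expRN -nE.
    by rewrite tc -expRM_natl -expRN -expRD; congr expR; lra.
  have -> : 2 * (n^-1 / expR (gamma / 2 * l)) * M%:R =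
     2 * (M%:R / n) / expR (gamma / 2 * l) by ring.
  by rewrite ler_pdivrMr ?expR_gt0 // mul1r; lra.
have t2 : 1 + (A + 1) * l <= theta * \sum_(u in S) survival K r M u [::].
  apply: (@le_trans _ _ (expR (gamma / 4 * l) / 2)); first by lra.
  apply: (@le_trans _ _ (theta * \sum_(u in S) n `^ (- (gamma / 4)) / 2)).
    rewrite sumr_const -[_ *+ #|S|]mulr_natl.
    apply: (@le_trans _ _ (theta * (n `^ (2^-1 + gamma) * (n `^ (- (gamma / 4)) / 2)))).
      rewrite /powR (gt_eqF n0) /theta -/l !mulrA -!expRD.
      by rewrite ler_wpM2r // ler_expR; lra.
    by rewrite ler_wpM2l ?expR_ge0 // ler_wpM2r // divr_ge0 ?powR_ge0.
  rewrite ler_wpM2l ?expR_ge0 //; apply: ler_sum => u uS.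
  by apply: survival_nil_ge => //; [exact: ltW|exact: ltW (hS u uS)|exact: hb].
by apply: le_trans (lerB t1 t2) _; lra.
Qed.

Lemma R2gamma_spec (R : realType) (gamma : R) (G : graph) :
  R2gamma gamma G = 0%N \/
  (0 < R2gamma gamma G)%N /\ exists S : {set G},
    #|G|%:R `^ (2^-1 + gamma) <= #|S|%:R /\
    forall u, u \in S -> (R2gamma gamma G)%:R * #|nball u (R2gamma gamma G)|%:R <
      ln (#|G|%:R : R).
Proof.
rewrite /R2gamma /nat_max; case: xgetP => [r _ [[r0 [S [h1 h2]]] _]|_]; last by left.
right; split => //; exists S; split => // u uS.
by have := h2 u uS; rewrite gballE.
Qed.

(** [D.+1 <= expR D] and [4 * D + 1 <= expR (4 * D)] bound the powers by [e = expR (gamma / 8 * l)];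
    a second factor [e] absorbs the rest, affine in [D] and [l]. *)
Lemma increment_bound (R : realType) (D r L : nat) (gamma l : R) : 0 <= l ->
  D%:R * r%:R <= gamma / 8 * l -> r%:R <= gamma / 16 * l ->
  4 * D%:R * L%:R <= gamma / 16 * l ->
  1 + 16 * D%:R + l <= expR (gamma / 8 * l) ->
  D.+1%:R ^+ r + expR r%:R * (4 * D%:R) * (4 * D%:R + 1) ^+ L * 2 +
    (l + 8 * D%:R) <= expR (gamma / 4 * l).
Proof.
move=> l0 h1 h2 h3; have D0 : 0 <= D%:R :> R by [].
have k1 : D.+1%:R ^+ r <= expR (gamma / 8 * l).
  apply: (@le_trans _ _ (expR D%:R ^+ r)); last by rewrite -expRM_natl ler_expR mulrC.
  by rewrite lerXn2r ?nnegrE ?expR_ge0 // -natr1 addrC; exact: expR_ge1Dx.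
have k2 : expR r%:R * (4 * D%:R + 1) ^+ L <= expR (gamma / 8 * l).
  have -> : gamma / 8 * l = gamma / 16 * l + gamma / 16 * l by field.
  have p0 : 0 <= 4 * D%:R + 1 :> R by rewrite addr_ge0 // mulr_ge0.
  rewrite expRD ler_pM ?expR_ge0 ?exprn_ge0 ?ler_expR //.
  apply: (@le_trans _ _ (expR (4 * D%:R) ^+ L)).
    by rewrite lerXn2r ?nnegrE ?expR_ge0 // addrC expR_ge1Dx.
  by rewrite -expRM_natl ler_expR mulrC.
have -> : gamma / 4 * l = gamma / 8 * l + gamma / 8 * l by field.
rewrite expRD; set e := expR _ in k1 k2 *.
have -> : expR r%:R * (4 * D%:R) * (4 * D%:R + 1) ^+ L * 2 =
   8 * D%:R * (expR r%:R * (4 * D%:R + 1) ^+ L) :> R by ring.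
move=> c6; have e1 : 1 <= e by clear k1 k2; lra.
apply: (@le_trans _ _ (e + 8 * D%:R * e + (l + 8 * D%:R) * e)).
  apply: lerD; last by rewrite ler_peMr // addr_ge0 // mulr_ge0.
  by apply: lerD; [exact: k1|rewrite ler_wpM2l // mulr_ge0].
have -> : e + 8 * D%:R * e + (l + 8 * D%:R) * e = (1 + 16 * D%:R + l) * e by ring.
by rewrite ler_wpM2r // expR_ge0.
Qed.

Lemma cover_time_lower (R : realType) (D : nat) (gamma A : R) :
  (0 < D)%N -> 0 < gamma -> gamma <= 2^-1 -> 0 < A ->
  exists l0 : R, forall G : graph, max_degree G = D -> l0 <= ln (#|G|%:R : R) ->
  forall (d : measure_display) (T : measurableType d) (P : probability T R)
         (W : nat -> T -> trajectory G),
    local_search_allocation P W ->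
    (P [set w | (Tcov R W w <
         (gamma * (R2gamma gamma G)%:R * #|G|%:R / (8 * D%:R))%:E)%E]
       <= (#|G|%:R `^ (- A))%:E)%E.
Proof.
move=> D0 gamma0 gamma1 A0; have D1 : 1 <= D%:R :> R by rewrite ler1n.
have D0R : 0 < D%:R :> R by rewrite ltr0n.
(* With [L] about [eps * ln n], [(4 * D + 1) ^ L] is at most [n ^ (gamma / 16)] and [K' ^ L.+1] at
   least [n ^ (A + 3)]. [X1] and [X2] serve to make [r] small against [gamma * ln n] once
   [r ^ 2 <= ln n]. *)
pose eps := gamma / (64 * D%:R).
have eps0 : 0 < eps by rewrite divr_gt0 //; lra.
pose eta := (A + 3) / eps; pose K' := expR eta.
pose X1 := 8 * D%:R / gamma; pose X2 := 16 / gamma.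
have [l0 [_ l0P]] : \forall l \near +oo,
  [/\ [/\ 1 <= l, X1 ^+ 2 <= l, X2 ^+ 2 <= l & K' ^+ 2 <= l],
      0 + 2 * l <= expR (1 * l),
      2 + 0 * l <= expR ((2^-1 + gamma / 4) * l),
      0 + 2 * l <= expR (gamma / 2 * l) &
      [/\ 2 + 2 * (A + 1) * l <= expR (gamma / 4 * l),
          8 * D%:R + 2 * l <= expR (gamma / 4 * l) &
          1 + 16 * D%:R + 1 * l <= expR (gamma / 8 * l)]].
  near=> l; split; [by split; near: l; exact: nbhs_pinfty_ge (num_real _)|..|split];
    by near: l; apply: affine_le_expR_near; lra.
exists (l0 + 1) => G GD; set n : R := #|G|%:R; set l := ln n => hl d T P W WP.
have l0l : l0 < l by apply: lt_le_trans hl; rewrite ltrDl.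
have := l0P l l0l; move=> [[l1 X1l X2l K'l2]].
rewrite add0r mul1r mul0r addr0 => c1 c2 c3 [c4 c5 c6] {l0P hl l0l}.
have n0 : 0 < n.
  by rewrite ltNge; apply/negP => /ln0 h; move: l1; rewrite /l h ler10.
have nE : n = expR l by rewrite lnK ?posrE.
have G0 : (0 < #|G|)%N by rewrite -(ltr0n R).
have pos : (0 <= (n `^ (- A))%:E)%E by rewrite lee_fin powR_ge0.
(* At the default value [0] the event is empty, as no time is negative. *)
have [->|[r0 [S [cardS hS]]]] := R2gamma_spec gamma G.
  rewrite mulr0 !mul0r (_ : mkset _ = set0) ?measure0 //.
  apply/seteqP; split => // w /= /Tcov_ltE[m []].
  by rewrite ltNge ler0n.
set r := R2gamma gamma G in r0 hS *.
set x := gamma * r%:R * n / (8 * D%:R); pose M := Num.truncn x.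
have r1 : 1 <= r%:R :> R by rewrite ler1n.
have x0 : 0 <= x.
  by rewrite divr_ge0 ?mulr_ge0 ?(ltW n0) ?(ltW gamma0) //; lra.
have hM : M%:R <= x by rewrite /M truncn_le.
pose cov w := forall u, u \in S -> (0 < load (history W M w) u)%N.
pose small L w := forall u, (load (history W M w) u <= L)%N.
have mcov L : measurable [set w | cov w /\ small L w].
  exact: (measurable_history WP M (fun h => (forall u, u \in S -> (0 < load h u)%N) /\
    forall u, (load h u <= L)%N)).
have Tcov_cov : [set w | (Tcov R W w < x%:E)%E] `<=` cov.
  move=> w /Tcov_ltE[m [mx h]] u _; apply: leq_trans (h u) _.
  by apply: load_history_le; rewrite /M truncn_ge_nat // ltW.
(* Room for two bad events of probability at most [n ^ (- (A + 1))] each. *)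
have half : 2 * expR (- ((A + 1) * l)) <= n `^ (- A).
  have -> : n `^ (- A) = expR (- (A * l)) by rewrite /powR (gt_eqF n0) mulNr.
  have -> : - (A * l) = - ((A + 1) * l) + l by ring.
  by rewrite expRD mulrC ler_wpM2l ?expR_ge0 //; lra.
have ball_l u : u \in S -> #|nball u r|%:R <= l.
  by move=> /hS /ltW; apply: le_trans; rewrite ler_peMl.
have one u : 1 <= #|nball u r|%:R :> R.
  by rewrite ler1n card_gt0; apply/set0Pn; exists u; exact: nball_self.
have [u0 u0S] : exists u0, u0 \in S.
  apply/card_gt0P; rewrite -(ltr0n R); apply: lt_le_trans cardS.
  exact: powR_gt0.
have r_l : r%:R <= l by apply: le_trans (ltW (hS u0 u0S)); rewrite ler_peMr.
have lge0 : 0 <= l by exact: le_trans l1.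
have Gpos : (0 < max_degree G)%N by rewrite GD.
have decay (L : nat) (kappa sigma : R) :
    (forall v, \sum_(u in S) (v \in nball u r)%:R <= kappa) ->
    (forall w, \sum_(u in S) (w \notin nball u r)%:R *
      dist_weight (4 * D%:R + 1) u w <= sigma) ->
    kappa + expR r%:R * (4 * D%:R) * (4 * D%:R + 1) ^+ L * sigma + (l + 8 * D%:R)
      <= expR (gamma / 4 * l) ->
    (P [set w | cov w /\ small L w] <= (expR (- ((A + 1) * l)))%:E)%E.
  move=> h1 h2 h3.
  apply: (@covered_prob_decay R G gamma A S r M L kappa sigma); rewrite ?GD //.
(* If every ball around a member of [S] is a whole component, then [sigma = 0] and the trivial load
   bound [M] suffices. Otherwise some such ball has more than [r] vertices, so [r ^ 2 <= ln n] and a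
   load bound of order [ln n] is available. *)
have [comp|] := pselect (forall u, u \in S ->
    forall k w, w \in nball u k -> w \in nball u r).
  apply: (@le_trans _ _ (P [set w | cov w /\ small M w])).
    apply: le_measure; rewrite ?inE //; first exact: (measurable_Tcov_lt WP).
    move=> w /Tcov_cov cw; split => // u.
    by apply: leq_trans (load_le_size _ _) _; rewrite size_history.
  apply: le_trans (decay M l 0 (overlap_component lge0 ball_l comp)
     (sum_far_weight_component _ comp) _) _.
    by rewrite mulr0 addr0; lra.
  rewrite lee_fin; apply: le_trans half; rewrite ler_peMl ?expR_ge0 //; lra.
move=> /existsNP[u /not_implyP[uS /existsNP[k /existsNP[z /not_implyP[zk /negP zr]]]]].
have rr : r%:R * r%:R <= l.
  apply: le_trans (ltW (hS u uS)); rewrite ler_wpM2l // ler_nat ltnW //.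
  exact: card_nball_gt zk zr.
have mul_r y : y ^+ 2 <= l -> r%:R * y <= l.
  by move=> hy; have := sqr_ge0 (r%:R - y); rewrite !expr2 in hy *; lra.
pose L := Num.truncn (eps * l).
have el0 : 0 <= eps * l by rewrite mulr_ge0 // ltW.
have L1 : L%:R <= eps * l by rewrite truncn_le.
have L2 : eps * l <= L.+1%:R by rewrite ltW // truncnS_gt.
have rX1 : D%:R * r%:R <= gamma / 8 * l.
  have h : r%:R * X1 <= l by exact: mul_r.
  have -> : D%:R * r%:R = gamma / 8 * (r%:R * X1) by rewrite /X1; field; rewrite gt_eqF.
  by rewrite ler_wpM2l //; lra.
have rX2 : r%:R <= gamma / 16 * l.
  have h : r%:R * X2 <= l by exact: mul_r.
  have -> : r%:R = gamma / 16 * (r%:R * X2) by rewrite /X2; field; rewrite gt_eqF.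
  by rewrite ler_wpM2l //; lra.
(* As powers of [n]: exponent [1] from the sum over vertices, at most [1] from the growth of the
   moments, and at most [- (A + 3)] from dividing by [K' ^ L.+1]. *)
have small_load : (P [set w | exists v, (L < load (history W M w) v)%N] <=
    (expR (- ((A + 1) * l)))%:E)%E.
  have K'1 : 1 <= K'.
    by rewrite /K' -[leLHS]expR0 ler_expR /eta divr_ge0 ?(ltW eps0) //; lra.
  apply: le_trans (max_load_prob_le G0 K'1 M L WP) _.
  rewrite lee_fin ler_pdivrMr ?exprn_gt0 ?expR_gt0 // -/n {1}nE -expRD.
  rewrite -expRM_natl -expRD ler_expR.
  have Mn : M%:R / n <= r%:R.
    have D8 : 0 < 8 * D%:R :> R by lra.
    rewrite ler_pdivrMr //; apply: le_trans hM _; rewrite /x ler_pdivrMr //.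
    have : 0 <= (8 * D%:R - gamma) * (r%:R * n).
      by rewrite mulr_ge0 ?mulr_ge0 ?(ltW n0) //; lra.
    by lra.
  have K'l : (K' - 1) * (M%:R / n) <= l.
    apply: (@le_trans _ _ (r%:R * K')); last exact: mul_r.
    rewrite mulrC ler_pM //; [|lra|lra].
    by rewrite divr_ge0 // ltW.
  have etaL : (A + 3) * l <= L.+1%:R * eta.
    have -> : (A + 3) * l = (eps * l) * eta by rewrite /eta; field; rewrite gt_eqF.
    by rewrite ler_wpM2r // /eta divr_ge0 ?(ltW eps0) //; lra.
  by lra.
have main : (P [set w | cov w /\ small L w] <= (expR (- ((A + 1) * l)))%:E)%E.
  apply: (decay L ((max_degree G).+1%:R ^+ r) 2).
  - exact: overlap_general.
  - apply: sum_far_weight_le; rewrite GD -natr1; lra.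
  rewrite GD; apply: increment_bound => //.
  have -> : gamma / 16 * l = 4 * D%:R * (eps * l) by rewrite /eps; field; rewrite gt_eqF.
  by rewrite ler_wpM2l // mulr_ge0.
have mload : measurable [set w | exists v, (L < load (history W M w) v)%N].
  exact: (measurable_history WP M (fun h => exists v, (L < load h v)%N)).
apply: (@le_trans _ _ (P ([set w | cov w /\ small L w] `|`
    [set w | exists v, (L < load (history W M w) v)%N]))).
  apply: le_measure; rewrite ?inE; [exact: (measurable_Tcov_lt WP)|exact: measurableU|].
  move=> w /Tcov_cov cw.
  have [|nl] := pselect (exists v, (L < load (history W M w) v)%N); first by right.
  left; split => // v; rewrite leqNgt; apply/negP => h; apply: nl; by exists v.
apply: le_trans (measureU2 _ _ _) _ => //.
apply: le_trans (leeD main small_load) _.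
by rewrite -EFinD lee_fin -mulr2n -mulr_natl.
Unshelve. all: by end_near.
Qed.

Theorem theorem5p2 (R : realType) (Delta : nat) (hDelta : (1 <= Delta)%N)
    (alpha : R) (halpha : 1 <= alpha) :
  exists C : R,
  forall gamma : R, 0 < gamma -> gamma <= 2^-1 ->
  forall A : R, 0 < A ->
  exists n0 : nat,
  forall G : graph, (n0 <= #|G|)%N -> max_degree G = Delta ->
  forall (d : measure_display) (T : measurableType d) (P : probability T R)
         (W : nat -> T -> trajectory G),
    local_search_allocation P W ->
    (P [set w | (Tcov R W w <
                 (gamma * (R2gamma gamma G)%:R * #|G|%:R / (8 * Delta%:R))%:E)%E]
       <= (#|G|%:R `^ (- A))%:E)%E /\
    (P [set w | ((C * (R2 R G)%:R * #|G|%:R)%:E <= Tcov R W w)%E]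
       <= (#|G|%:R `^ (- alpha))%:E)%E.
Proof.
have [C upper] := cover_time_upper Delta (le_trans ler01 halpha).
exists C => gamma gamma0 gamma1 A A0.
have [l0 lower] := cover_time_lower hDelta gamma0 gamma1 A0.
exists (Num.truncn (expR (Num.max 2 l0))).+1 => G nG GD d T P W WP.
have : Num.max 2 l0 <= ln (#|G|%:R : R).
  rewrite -[leLHS]expRK ler_ln ?posrE ?expR_gt0 //; last first.
    by rewrite ltr0n; exact: leq_trans nG.
  by apply: le_trans (ltW (truncnS_gt _)) _; rewrite ler_nat.
rewrite ge_max => /andP[l2 ll0].
by split; [exact: lower|exact: upper].
Qed.
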